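(* The group $B_7/[P_7,P_7]$ possesses a unique conjugacy class of subgroups isomorphic to the Frobenius group $\mathcal{F}$ of order $21$.
   Context: $B_7$ is the Artin braid group with generators $\sigma_1,\ldots,\sigma_6$ and relations $\sigma_i\sigma_j=\sigma_j\sigma_i$ for $|i-j|\geq 2$, and $\sigma_{i+1}\sigma_i\sigma_{i+1}=\sigma_i\sigma_{i+1}\sigma_i$ for $1\leq i\leq 5$. $P_7$ is the pure braid group, i.e. the kernel of the homomorphism $\sigma\colon B_7\to S_7$ with $\sigma(\sigma_i)=(i,i+1)$, and $[P_7,P_7]$ is its commutator subgroup. The Frobenius group of order $21$ is $\mathcal{F}=\langle s,t\mid s^3=t^7=1,\ sts^{-1}=t^2\rangle$. *)

(* Defs.v *)
(* The groups involved may be infinite, so they are [groupType]s (not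
   [finGroupType]s) and their subsets are classical [set]s. *)
From HB Require Import structures.
From mathcomp Require Import all_boot fingroup perm.
From mathcomp Require Import generic_quotient zify.
From mathcomp Require Import boolp classical_sets.

Set Implicit Arguments.
Unset Strict Implicit.
Unset Printing Implicit Defensive.

Local Open Scope quotient_scope.
Local Open Scope classical_set_scope.
Local Open Scope group_scope.

(* The letter (x, false) stands for x and (x, true) for its inverse. *)
Definition word (X : Type) := seq (X * bool).
Definition gen {X : Type} (x : X) : word X := [:: (x, false)].
Definition winv {X : Type} (w : word X) : word X :=
  rev [seq (l.1, ~~ l.2) | l <- w].
Definition wexp {X : Type} (w : word X) (n : nat) : word X :=
  flatten (nseq n w).

(* A relation R u v is read as the relator equation u = v. *)
Inductive pres_eq (X : Type) (R : word X -> word X -> Prop) :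
    word X -> word X -> Prop :=
| PresRel u v of R u v : pres_eq R u v
| PresCancel x b : pres_eq R [:: (x, b); (x, ~~ b)] [::]
| PresCat u u' v v' of pres_eq R u u' & pres_eq R v v' :
    pres_eq R (u ++ v) (u' ++ v')
| PresRefl u : pres_eq R u u
| PresSym u v of pres_eq R u v : pres_eq R v u
| PresTrans u v w of pres_eq R u v & pres_eq R v w : pres_eq R u w.

Section Presentation.
Variables (X : choiceType) (R : word X -> word X -> Prop).

Definition pres_rel : rel (word X) := fun u v => `[< pres_eq R u v >].

Fact pres_rel_refl : reflexive pres_rel.
Proof. by move=> u; apply/asboolP; exact: PresRefl. Qed.

Fact pres_rel_sym : symmetric pres_rel.
Proof. by move=> u v; apply/asboolP/asboolP; exact: PresSym. Qed.

Fact pres_rel_trans : transitive pres_rel.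
Proof.
by move=> v u w /asboolP uv /asboolP vw; apply/asboolP; exact: PresTrans vw.
Qed.

Canonical pres_equiv := EquivRel pres_rel pres_rel_refl pres_rel_sym pres_rel_trans.

Definition presented := {eq_quot pres_equiv}.
HB.instance Definition _ := Choice.on presented.
HB.instance Definition _ := Quotient.on presented.

Lemma presP u v : pres_eq R u v <-> \pi u = \pi v :> presented.
Proof.
by split=> [uv|/eqmodP /asboolP //]; apply/eqmodP/asboolP.
Qed.

Lemma pres_reprK u : pres_eq R (repr (\pi u : presented)) u.
Proof. by apply/presP; rewrite reprK. Qed.

Lemma winv_cat (u v : word X) : winv (u ++ v) = winv v ++ winv u.
Proof. by rewrite /winv map_cat rev_cat. Qed.

Lemma winvK : involutive (@winv X).
Proof.
move=> u; rewrite /winv map_rev revK -map_comp -[RHS]map_id.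
by apply: eq_map => -[x b] /=; rewrite negbK.
Qed.

Lemma pres_eqV u : pres_eq R (u ++ winv u) [::].
Proof.
elim: u => [|[x b] u IH]; first exact: PresRefl.
rewrite -cat1s winv_cat -catA (catA u).
apply: PresTrans (PresCancel R x b).
rewrite -[[:: (x, b); _]]/([:: (x, b)] ++ [::] ++ [:: (x, ~~ b)]).
apply: PresCat (PresRefl _ _) _; apply: PresCat IH (PresRefl _ _).
Qed.

Lemma pres_eq_winv u v : pres_eq R u v -> pres_eq R (winv u) (winv v).
Proof.
move=> uv; apply: (@PresTrans _ _ _ (winv u ++ (v ++ winv v))).
  rewrite -{1}[winv u]cats0; apply: PresCat (PresRefl _ _) _.
  exact/PresSym/pres_eqV.
rewrite catA -{2}[winv v]cat0s; apply: PresCat (PresRefl _ _).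
apply: (@PresTrans _ _ _ (winv u ++ u)).
  by apply: PresCat (PresRefl _ _) _; exact: PresSym.
by rewrite -{2}[u]winvK; exact: pres_eqV.
Qed.

Definition pres_mul (x y : presented) : presented := \pi_presented (repr x ++ repr y).
Definition pres_one : presented := \pi [::].
Definition pres_inv (x : presented) : presented := \pi_presented (winv (repr x)).

Lemma pres_mulE u v :
  pres_mul (\pi u) (\pi v) = \pi_presented (u ++ v).
Proof. by apply/presP/PresCat; exact: pres_reprK. Qed.

Lemma pres_invE u : pres_inv (\pi u) = \pi_presented (winv u).
Proof. by apply/presP/pres_eq_winv; exact: pres_reprK. Qed.

Fact pres_mulA : associative pres_mul.
Proof.
move=> x y z; rewrite -[x]reprK -[y]reprK -[z]reprK.
by rewrite !pres_mulE catA.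
Qed.

Fact pres_mul1 : left_id pres_one pres_mul.
Proof. by move=> x; rewrite -[x]reprK pres_mulE. Qed.

Fact pres_mulr1 : right_id pres_one pres_mul.
Proof. by move=> x; rewrite -[x]reprK pres_mulE cats0. Qed.

Fact pres_mulV : right_inverse pres_one pres_inv pres_mul.
Proof.
move=> x; rewrite -[x]reprK pres_invE pres_mulE.
by apply/presP; exact: pres_eqV.
Qed.

Fact pres_mulVl : left_inverse pres_one pres_inv pres_mul.
Proof.
move=> x; rewrite -[x]reprK pres_invE pres_mulE.
by apply/presP; rewrite -{2}[repr x]winvK; exact: pres_eqV.
Qed.

HB.instance Definition _ :=
  isGroup.Build presented pres_mulA pres_mul1 pres_mulr1 pres_mulVl pres_mulV.

Definition pres_gen (x : X) : presented := \pi_presented (gen x).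

Section Lift.
Variables (H : groupType) (f : X -> H).

Definition eval_letter (l : X * bool) : H := if l.2 then (f l.1)^-1 else f l.1.
Definition eval_word (w : word X) : H := \prod_(l <- w) eval_letter l.

Hypothesis fR : forall u v, R u v -> eval_word u = eval_word v.

Lemma eval_pres_eq u v : pres_eq R u v -> eval_word u = eval_word v.
Proof.
elim=> {u v} [u v /fR //|x b||//|//|u v w _ -> //].
- rewrite /eval_word !big_cons !big_nil mulg1 /eval_letter /=.
  by case: b => /=; rewrite ?mulVg ?mulgV.
- by move=> u u' v v' _ + _; rewrite /eval_word !big_cat /= => -> ->.
Qed.

(* The proof fR is an argument so that the morphism structure can be attached
   to the function itself. *)
Definition pres_lift of (forall u v, R u v -> eval_word u = eval_word v) :
  presented -> H := fun x => eval_word (repr x).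

Lemma pres_liftE w : pres_lift fR (\pi w) = eval_word w.
Proof. exact/eval_pres_eq/pres_reprK. Qed.

Lemma pres_lift_gen x : pres_lift fR (pres_gen x) = f x.
Proof. by rewrite pres_liftE /eval_word big_seq1. Qed.

Fact pres_liftM : {morph pres_lift fR : x y / x * y}.
Proof.
move=> x y; rewrite -[x]reprK -[y]reprK [_ * _]pres_mulE !pres_liftE.
by rewrite /eval_word big_cat.
Qed.
End Lift.
End Presentation.

HB.instance Definition _ (X : choiceType) (R : word X -> word X -> Prop)
  (H : groupType) (f : X -> H)
  (fR : forall u v, R u v -> eval_word f u = eval_word f v) :=
  isMultiplicative.Build (presented R) H (pres_lift fR) (pres_liftM fR).

Section Subgroups.
Variable G : groupType.

Definition is_subgroup (H : set G) :=
  H 1 /\ forall x y, H x -> H y -> H (x / y).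

Definition generated (A : set G) : set G :=
  [set x | forall H, is_subgroup H -> A `<=` H -> H x].

Definition conj_set (H : set G) (g : G) : set G := [set h ^ g | h in H].

Record normal_subgroup := NormalSubgroup {
  normal_set :> G -> Prop;
  normal_subgroupP : is_subgroup normal_set;
  normalJ : forall x g, normal_set x -> normal_set (x ^ g) }.

Lemma normal1 (N : normal_subgroup) : N 1.
Proof. by case: (normal_subgroupP N). Qed.

Lemma normalF (N : normal_subgroup) x y : N x -> N y -> N (x / y).
Proof. by case: (normal_subgroupP N) => _; apply. Qed.

Lemma normalV (N : normal_subgroup) x : N x -> N x^-1.
Proof. by move=> Nx; rewrite -div1g; exact: normalF (normal1 N) Nx. Qed.

Lemma normalM (N : normal_subgroup) x y : N x -> N y -> N (x * y).
Proof. by move=> Nx Ny; rewrite -[y]invgK; exact: normalF Nx (normalV Ny). Qed.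

Lemma generated_subgroup (A : set G) : is_subgroup (generated A).
Proof.
split=> [H [] //|x y Ax Ay H sH AH].
by case: (sH) => _; apply; [exact: Ax | exact: Ay].
Qed.

Definition commutators (A : set G) : set G :=
  [set z | exists x y, [/\ A x, A y & z = [~ x, y]]].

Fact derived_subproof (N : normal_subgroup) x g :
  generated (commutators (normal_set N)) x -> generated (commutators (normal_set N)) (x ^ g).
Proof.
move=> Nx H [H1 HF] NH; apply: (Nx [set y | H (y ^ g)]).
  by split=> [|a b /= Ha Hb]; rewrite /= ?conj1g // conjMg conjVg; exact: HF.
move=> _ [a [b [Na Nb ->]]] /=; apply: NH; rewrite conjRg.
by exists (a ^ g), (b ^ g); split=> //; exact: normalJ.
Qed.

Definition derived (N : normal_subgroup) : normal_subgroup :=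
  NormalSubgroup (generated_subgroup (commutators (normal_set N))) (@derived_subproof N).
End Subgroups.

Section Kernel.
Variables (G H : groupType) (f : {multiplicative G -> H}).

Lemma mult1 : f 1 = 1.
Proof. by apply: (@mulgI _ (f 1)); rewrite -gmulfM !mulg1. Qed.

Lemma multV x : f x^-1 = (f x)^-1.
Proof. by apply: (@mulgI _ (f x)); rewrite -gmulfM !mulgV mult1. Qed.

Fact ker_subgroup : is_subgroup [set x | f x = 1].
Proof.
split=> [|x y /= fx fy]; first exact: mult1.
by rewrite /= gmulfM multV fx fy mulgV.
Qed.

Fact ker_normal x g : f x = 1 -> f (x ^ g) = 1.
Proof. by move=> fx; rewrite !gmulfM multV fx mul1g mulVg. Qed.

Definition kernel : normal_subgroup G := NormalSubgroup ker_subgroup ker_normal.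
End Kernel.

Section QuotientGroup.
Variables (G : groupType) (N : normal_subgroup G).

Definition coset_rel : rel G := fun x y => `[< N (x^-1 * y) >].

Fact coset_rel_refl : reflexive coset_rel.
Proof. by move=> x; apply/asboolP; rewrite mulVg; exact: normal1. Qed.

Fact coset_rel_sym : symmetric coset_rel.
Proof.
by move=> x y; apply/asboolP/asboolP => /normalV; rewrite invgM invgK.
Qed.

Fact coset_rel_trans : transitive coset_rel.
Proof.
move=> y x z /asboolP xy /asboolP yz; apply/asboolP.
by have := normalM xy yz; rewrite -mulgA mulVKg.
Qed.

Canonical coset_equiv :=
  EquivRel coset_rel coset_rel_refl coset_rel_sym coset_rel_trans.

Definition quot := {eq_quot coset_equiv}.
HB.instance Definition _ := Choice.on quot.
HB.instance Definition _ := Quotient.on quot.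

Lemma quotP x y : N (x^-1 * y) <-> \pi x = \pi y :> quot.
Proof.
by split=> [xy|/eqmodP /asboolP //]; apply/eqmodP/asboolP.
Qed.

Lemma quot_reprK x : N ((repr (\pi x : quot))^-1 * x).
Proof. by apply/quotP; rewrite reprK. Qed.

Definition quot_mul (x y : quot) : quot := \pi_quot (repr x * repr y).
Definition quot_one : quot := \pi 1.
Definition quot_inv (x : quot) : quot := \pi_quot (repr x)^-1.

Lemma quot_mulE x y : quot_mul (\pi x) (\pi y) = \pi_quot (x * y).
Proof.
apply/quotP; set a := repr _; set b := repr _.
have -> : (a * b)^-1 * (x * y) = (a^-1 * x) ^ b * (b^-1 * y).
  by rewrite conjgE invgM !mulgA mulgK.
by apply: normalM (quot_reprK y); apply: normalJ; exact: quot_reprK.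
Qed.

Lemma quot_invE x : quot_inv (\pi x) = \pi x^-1.
Proof.
apply/quotP; set a := repr _; rewrite invgK.
have -> : a * x^-1 = (a^-1 * x)^-1 ^ a^-1.
  by rewrite conjgE invgM !invgK !mulgA mulgK.
by apply: normalJ; apply: normalV; exact: quot_reprK.
Qed.

Fact quot_mulA : associative quot_mul.
Proof.
move=> x y z; rewrite -[x]reprK -[y]reprK -[z]reprK.
by rewrite !quot_mulE mulgA.
Qed.

Fact quot_mul1 : left_id quot_one quot_mul.
Proof. by move=> x; rewrite -[x]reprK quot_mulE mul1g. Qed.

Fact quot_mulr1 : right_id quot_one quot_mul.
Proof. by move=> x; rewrite -[x]reprK quot_mulE mulg1. Qed.

Fact quot_mulVl : left_inverse quot_one quot_inv quot_mul.
Proof. by move=> x; rewrite -[x]reprK quot_invE quot_mulE mulVg. Qed.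

Fact quot_mulV : right_inverse quot_one quot_inv quot_mul.
Proof. by move=> x; rewrite -[x]reprK quot_invE quot_mulE mulgV. Qed.

HB.instance Definition _ :=
  isGroup.Build quot quot_mulA quot_mul1 quot_mulr1 quot_mulVl quot_mulV.
End QuotientGroup.

(* The group on n strands; indices start at 0: the generator with index i is sigma_(i+1). *)
Inductive artin_rel (n : nat) : word 'I_n.-1 -> word 'I_n.-1 -> Prop :=
| ArtinComm (i j : 'I_n.-1) of (i.+1 < j)%N || (j.+1 < i)%N :
    artin_rel (gen i ++ gen j) (gen j ++ gen i)
| ArtinBraid (i j : 'I_n.-1) of j = i.+1 :> nat :
    artin_rel (gen j ++ gen i ++ gen j) (gen i ++ gen j ++ gen i).

Definition braid_group (n : nat) : groupType := presented (@artin_rel n).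

Definition strand_l n (i : 'I_n.-1) : 'I_n := widen_ord (leq_pred n) i.
Definition strand_r n (i : 'I_n.-1) : 'I_n :=
  Ordinal (etrans (esym (ltn_predRL i n)) (ltn_ord i)).
Definition adj_transp n (i : 'I_n.-1) : 'S_n := tperm (strand_l i) (strand_r i).

Fact artin_rel_transp n u v :
  artin_rel u v -> eval_word (@adj_transp n) u = eval_word (@adj_transp n) v.
Proof.
have neq (a b : 'I_n) : a != b :> nat -> a != b by [].
case=> {u v} i j ij; rewrite /eval_word !big_cat !big_seq1 /eval_letter /=.
  apply: (@mulgI _ (adj_transp j)^-1); rewrite mulKg -conjgE tpermJ.
  have [ij1 ij2 ij3 ij4] : [/\ j != i :> nat, j != i.+1 :> nat,
      j.+1 != i :> nat & j.+1 != i.+1 :> nat].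
    by split; apply/eqP => e; move: ij; lia.
  by rewrite !tpermD //; apply: neq.
have e : strand_l j = strand_r i by apply: val_inj.
have [ac bc] : strand_l i != strand_r j /\ strand_r i != strand_r j.
  by split; apply: neq => /=; lia.
have ab : strand_l i != strand_r i by apply: neq => /=; lia.
have J p q : adj_transp p * (adj_transp q * adj_transp p)
    = adj_transp q ^ adj_transp p by rewrite conjgE tpermV.
rewrite !J /adj_transp !tpermJ e tpermL tpermR.
by rewrite !tpermD // eq_sym.
Qed.

(* MathComp composes permutations left to right; since transpositions are
   involutions, the other convention changes this morphism by inversion in 'S_n
   only and yields the same kernel. *)
Definition braid_perm n : {multiplicative braid_group n -> 'S_n} :=
  pres_lift (@artin_rel_transp n).

Lemma braid_perm_gen n (i : 'I_n.-1) :
  braid_perm n (pres_gen _ i) = tperm (strand_l i) (strand_r i).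
Proof. exact: pres_lift_gen. Qed.

Definition pure_braid (n : nat) : normal_subgroup (braid_group n) :=
  kernel (braid_perm n).

(* The two generators s and t are indexed by bool. *)
Definition frob_s : word bool := gen false.
Definition frob_t : word bool := gen true.

Inductive frobenius_rel : word bool -> word bool -> Prop :=
| FrobS : frobenius_rel (wexp frob_s 3) [::]
| FrobT : frobenius_rel (wexp frob_t 7) [::]
| FrobConj : frobenius_rel (frob_s ++ frob_t ++ winv frob_s) (wexp frob_t 2).

Definition frobenius21 : groupType := presented frobenius_rel.

(* For a subgroup H of G, such an f is an isomorphism from F onto H. *)
Definition isog_subgroup (F G : groupType) (H : set G) :=
  exists f : {multiplicative F -> G}, injective f /\ range f = H.

Definition conj_class (G : groupType) (H : set G) : set (set G) :=
  range (conj_set H).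

(* Main.v *)
Require Import Defs.
From HB Require Import structures.
From mathcomp Require Import all_boot all_order all_algebra fingroup perm.
From mathcomp Require Import generic_quotient.
From mathcomp Require Import boolp classical_sets.
From mathcomp Require Import zify.

(* The permutation underlying a braid together with the signed number of
   crossings of each pair of strands gives a morphism from B_n to the
   semidirect product of the integer functions on pairs by S_n. It kills
   [P_n, P_n], and the induced morphism on B_n/[P_n, P_n] is injective: by the
   Coxeter presentation of S_n, P_n is generated by the conjugates of the
   sigma_i^2; these are all conjugate to sigma_1^2, and modulo [P_n, P_n] the
   conjugate of sigma_1^2 by g depends only on the pair to which g sends {1,2},
   so that P_n/[P_n, P_n] is spanned by one element for each pair of strands,
   and the linking numbers show that these elements are independent.

   For n = 7, a subgroup isomorphic to the Frobenius group maps injectively to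
   S_7, since P_7/[P_7, P_7] is torsion-free, and its image is conjugate to
   <i |-> 4i, i |-> i+1> on Z/7. This group acts regularly on the 21 pairs, so
   that P_7/[P_7, P_7] is a free module of rank 1 over its group ring: H^2 = 0
   provides the lift, given below by explicit braids, and H^1 = 0 its
   uniqueness up to conjugacy. *)

Set Implicit Arguments.
Unset Strict Implicit.
Unset Printing Implicit Defensive.

Import GRing.Theory.
Local Open Scope group_scope.

(** * The Coxeter presentation of the symmetric group *)

Section Coxeter.
Variables (W : groupType) (N : nat) (s : nat -> W).
Hypothesis ss : forall i, (i < N)%N -> s i * s i = 1.
Hypothesis sC : forall i j, (i.+1 < j)%N -> (j < N)%N -> s i * s j = s j * s i.
Hypothesis sB : forall i, (i.+1 < N)%N ->
  s i.+1 * (s i * s i.+1) = s i * (s i.+1 * s i).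

Definition word_prod (w : seq nat) : W := \prod_(i <- w) s i.

Lemma word_prod_cat u v : word_prod (u ++ v) = word_prod u * word_prod v.
Proof. by rewrite /word_prod big_cat. Qed.

Lemma word_prod1 i : word_prod [:: i] = s i.
Proof. by rewrite /word_prod big_seq1. Qed.

(* [descent k d] is the word k-1, k-2, ..., k-d. *)
Fixpoint descent (k d : nat) : seq nat :=
  if d is d'.+1 then rcons (descent k d') (k - d)%N else [::].

Lemma word_prod_rcons w i : word_prod (rcons w i) = word_prod w * s i.
Proof. by rewrite -cats1 word_prod_cat word_prod1. Qed.

Lemma word_prod_comm w i : (i < N)%N ->
  all (fun j => (j < N) && ((i.+1 < j) || (j.+1 < i)))%N w ->
  word_prod w * s i = s i * word_prod w.
Proof.
move=> iN; elim: w => [|j w IH] /=; first by rewrite /word_prod big_nil mulg1 mul1g.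
case/andP=> /andP[jN ij] /IH {}IH; rewrite -cat1s word_prod_cat word_prod1 -mulgA IH.
rewrite !mulgA; congr (_ * _).
by case/orP: ij => ij; [rewrite -sC | rewrite sC].
Qed.

Lemma all_descent k d (P : pred nat) : (d <= k)%N ->
  (forall j, (k - d <= j < k)%N -> P j) -> all P (descent k d).
Proof.
elim: d => [//|d IH] dk HP /=; rewrite all_rcons HP ?IH //=; try lia.
by move=> j jk; apply: HP; lia.
Qed.

(** If [i + 1 < k - d], the letter commutes with the whole descent; if [i + 1 = k - d], it lengthens
    the descent; if [i = k - d], it cancels the last letter. A larger [i] passes through by one
    braid relation and comes out as [i - 1]. *)
Lemma descent_mul k d i : (k <= N)%N -> (d <= k)%N -> (i < k)%N ->
  exists w d', [/\ all (fun j => j.+1 < k)%N w, (d' <= k)%N &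
    word_prod (descent k d) * s i = word_prod w * word_prod (descent k d')].
Proof.
move=> kN dk ik.
have e1 : word_prod [::] = 1 by rewrite /word_prod big_nil.
have [ilt|] := ltnP i.+1 (k - d).
  exists [:: i], d; split=> //=; first by lia.
  rewrite word_prod1 word_prod_comm //; first by lia.
  by apply: all_descent => // j jk; lia.
rewrite leq_eqVlt => /orP[/eqP ieq|igt].
  exists [::], d.+1; split=> //=; first by lia.
  by rewrite e1 mul1g word_prod_rcons; congr (_ * s _); lia.
have [ieq|igt2] := eqVneq i (k - d)%N.
  case: d dk igt ieq => [|d] dk igt ieq; first by lia.
  exists [::], d; split=> //; first by lia.
  by rewrite e1 mul1g /= word_prod_rcons ieq -mulgA ss ?mulg1 //; lia.
exists [:: i.-1], d; split=> //=; first by lia.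
have {igt igt2} : (k - d < i)%N by lia.
elim: d dk => [|d IH] dk igt; first by lia.
rewrite /= word_prod_rcons word_prod1.
have [{}igt|] := ltnP (k - d) i.
  rewrite -mulgA sC; [|by lia|by lia].
  by rewrite mulgA IH ?word_prod1 // -?mulgA //; lia.
move=> ile; have {ile igt}ieq : i = (k - d)%N by lia.
case: d dk IH ieq => [|d] dk _ ieq; first by lia.
rewrite /= word_prod_rcons -!mulgA.
have -> : (k - d.+2 = i.-1)%N by lia.
rewrite -ieq; case: i ieq ik => [|i] ieq ik; first by lia.
rewrite /= sB; last by lia.
rewrite !mulgA; congr (_ * _ * _); apply: word_prod_comm; first by lia.
by apply: all_descent => [|j jk]; lia.
Qed.

(** The descents meet every coset of the subgroup of the generators below [k - 1] in that of the
    generators below [k]. *)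
Lemma coxeter_descent k w : (k <= N)%N -> all (fun j => j < k)%N w ->
  exists w' d, [/\ all (fun j => j.+1 < k)%N w', (d <= k)%N &
    word_prod w = word_prod w' * word_prod (descent k d)].
Proof.
move=> kN; elim/last_ind: w => [|w i IH].
  by exists [::], 0; rewrite /= /word_prod big_nil mulg1.
rewrite all_rcons => /andP[ik /IH[w' [d [w'k dk e]]]].
have [w2 [d' [w2k d'k e']]] := descent_mul kN dk ik.
exists (w' ++ w2), d'; split=> //; first by rewrite all_cat w'k.
by rewrite word_prod_rcons e -mulgA e' word_prod_cat mulgA.
Qed.
End Coxeter.

Section CoxeterPerm.
Variables (W : groupType) (N : nat) (s : nat -> W).
Hypothesis ss : forall i, (i < N)%N -> s i * s i = 1.
Hypothesis sC : forall i j, (i.+1 < j)%N -> (j < N)%N -> s i * s j = s j * s i.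
Hypothesis sB : forall i, (i.+1 < N)%N ->
  s i.+1 * (s i * s i.+1) = s i * (s i.+1 * s i).

Definition nat_transp (i : nat) : 'S_N.+1 := tperm (inord i) (inord i.+1).

Lemma inord_inj (i j : nat) : (i <= N)%N -> (j <= N)%N ->
  ((inord i : 'I_N.+1) == inord j) = (i == j).
Proof. by move=> iN jN; rewrite -val_eqE /= !inordK. Qed.

Lemma nat_transpE i (x : 'I_N.+1) : (i < N)%N ->
  nat_transp i x = (if x == i :> nat then i.+1
    else if x == i.+1 :> nat then i else x) :> nat.
Proof.
move=> iN; rewrite /nat_transp; have [->|xi|] := tpermP.
- by rewrite !inordK ?eqxx //; lia.
- by rewrite xi !inordK ?eqxx //; [case: ifP => //; lia | lia].
move=> /eqP; rewrite -val_eqE /= inordK; last by lia.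
move=> /negbTE -> /eqP; rewrite -val_eqE /= inordK; last by lia.
by move=> /negbTE ->.
Qed.

Lemma nat_transpC i j : (i.+1 < j)%N -> (j < N)%N ->
  nat_transp i * nat_transp j = nat_transp j * nat_transp i.
Proof.
move=> ij jN; apply/permP => x; rewrite !permM; apply: val_inj => /=.
by rewrite !nat_transpE; try lia; repeat case: eqP => //=; lia.
Qed.

Lemma nat_transpB i : (i.+1 < N)%N ->
  nat_transp i.+1 * (nat_transp i * nat_transp i.+1) =
  nat_transp i * (nat_transp i.+1 * nat_transp i).
Proof.
move=> iN; apply/permP => x; rewrite !permM; apply: val_inj => /=.
by rewrite !nat_transpE; try lia; repeat case: eqP => //=; lia.
Qed.

Lemma fix_word_prod k w (x : 'I_N.+1) : (k <= x)%N -> (x <= N)%N ->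
  all (fun j => j.+1 < k)%N w -> word_prod nat_transp w x = x.
Proof.
move=> kx xN; elim: w => [|i w IH] /=; first by rewrite /word_prod big_nil perm1.
case/andP=> ik /IH {}IH; rewrite -cat1s word_prod_cat word_prod1 permM.
suff -> : nat_transp i x = x by [].
by apply: val_inj; rewrite /= nat_transpE; [case: eqP => [|_]; [lia|case: eqP; lia]|lia].
Qed.

Lemma word_prod_descent k d : (k <= N)%N -> (d <= k)%N ->
  word_prod nat_transp (descent k d) (inord k) = (k - d)%N :> nat.
Proof.
move=> kN; elim: d => [|d IH] dk.
  by rewrite /word_prod big_nil perm1 inordK ?subn0.
rewrite /= word_prod_rcons permM nat_transpE; last by lia.
by rewrite IH; [case: eqP => [|_]; [lia|case: eqP; lia]|lia].
Qed.

(* The product group forces the same normal form on both sides; then the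
   images of N, N-1, ... under the permutation determine the descents. *)
Lemma coxeter_presentation w : all (fun j => j < N)%N w ->
  word_prod nat_transp w = 1 -> word_prod s w = 1.
Proof.
pose t i : (W * 'S_N.+1)%type := (s i, nat_transp i).
have tE u : word_prod t u = (word_prod s u, word_prod nat_transp u).
  by elim: u => [|i u IH]; rewrite /word_prod ?big_nil // !big_cons -!/(word_prod _ _) IH.
have {}tE u : word_prod s u = (word_prod t u).1 /\
    word_prod nat_transp u = (word_prod t u).2.
  by rewrite tE.
(* The induction is on the bound [k] of the letters; the [N] of the relations stays fixed. *)
have: (N <= N)%N by [].
move: {1 3}N w => k; elim: k => [|k IH] w kN wk.
  by case: w wk => // _; rewrite /word_prod !big_nil.
have tt i : (i < N)%N -> t i * t i = 1.
  by move=> iN; congr pair; [exact: ss | exact: tperm2].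
have tC i j : (i.+1 < j)%N -> (j < N)%N -> t i * t j = t j * t i.
  by move=> ij jN; congr pair; [exact: sC | exact: nat_transpC].
have tB i : (i.+1 < N)%N -> t i.+1 * (t i * t i.+1) = t i * (t i.+1 * t i).
  by move=> iN; congr pair; [exact: sB | exact: nat_transpB].
have [w' [d [w'k dk e]]] := coxeter_descent tt tC tB kN wk.
have [-> ->] := tE w; rewrite {}e /= -!(proj1 (tE _)) -!(proj2 (tE _)) => e1.
have d0 : d = 0.
  move/permP/(_ (inord k.+1))/(congr1 val): (e1).
  rewrite permM (fix_word_prod _ _ w'k) ?inordK //= word_prod_descent //.
  by rewrite perm1 inordK //; lia.
move: e1; rewrite d0 /= {2 4}/word_prod !big_nil !mulg1; apply: IH => //.
  by lia.
Qed.
End CoxeterPerm.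

(** * Permutations with signed crossing numbers *)

(** Transpositions of points from [k] on are products of adjacent ones, and they bring the points
    moved by [p] back one at a time. The case [k = 0] covers the whole symmetric group, [k = 2] the
    stabiliser of the first two points. *)
Lemma transp_ind N (Q : 'S_N.+1 -> Prop) k :
  Q 1 -> (forall x y, Q x -> Q y -> Q (x * y)) ->
  (forall i, (k <= i < N)%N -> Q (nat_transp N i)) ->
  forall p : 'S_N.+1, (forall i : 'I_N.+1, (i < k)%N -> p i = i) -> Q p.
Proof.
move=> Q1 QM Qs.
have Qt (i j : 'I_N.+1) : (k <= i)%N -> (i < j)%N -> Q (tperm i j).
  move=> ki; case: j => j /= jN ij; elim: j jN ij => [//|j IH] jN ij.
  have jN' : (j < N.+1)%N by lia.
  have -> : Ordinal jN = inord j.+1 by apply: val_inj; rewrite /= inordK.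
  have [eij|nij] := eqVneq (i : nat) j.
    have -> : i = inord j by apply: val_inj; rewrite /= inordK.
    by apply: Qs; lia.
  have {IH}Qij := IH jN' ltac:(lia).
  have -> : tperm i (inord j.+1) =
      (nat_transp N j * tperm i (Ordinal jN')) * nat_transp N j.
    rewrite -mulgA -{1}[nat_transp N j]tpermV -conjgE tpermJ; congr tperm.
      by rewrite tpermD // -val_eqE /= inordK //; lia.
    have -> : Ordinal jN' = inord j by apply: val_inj; rewrite /= inordK.
    by rewrite tpermL.
  have Qj : Q (nat_transp N j) by apply: Qs; lia.
  by apply: (QM) => //; apply: QM.
suff H d : forall p : 'S_N.+1, (d <= N.+1 - k)%N ->
    (forall i : 'I_N.+1, (i < N.+1 - d)%N -> p i = i) -> Q p.
  move=> p pk; have [kN|Nk] := leqP k N.+1.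
    by apply: (H (N.+1 - k)%N) => // i; rewrite subKn //; exact: pk.
  suff -> : p = 1 by [].
  by apply/permP => i; rewrite perm1 pk //; apply: leq_trans (ltn_ord i) _; lia.
elim: d => [|d IH] p dk pf.
  suff -> : p = 1 by [].
  by apply/permP => i; rewrite perm1 pf // subn0.
(* [x] is the first point that [p] may move; composing with [tperm x (p x)] fixes it as well. *)
have xN : (N.+1 - d.+1 < N.+1)%N by lia.
pose x := Ordinal xN.
have pxx : (x <= p x)%N.
  rewrite leqNgt; apply/negP => px.
  have /perm_inj e : p (p x) = p x by apply: pf.
  by move: px; rewrite e ltnn.
have Qp' : Q (p * tperm x (p x)).
  apply: IH => [|i idn]; first by lia.
  rewrite permM; have [ix|ix] := ltnP i x.
    rewrite (pf i ix) tpermD // -val_eqE neq_ltn ?ix ?orbT //.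
    by rewrite (leq_trans ix pxx) orbT.
  have -> : i = x by apply: val_inj => /=; move: idn ix => /=; lia.
  by rewrite tpermR.
rewrite -[p](mulgK (tperm x (p x))) tpermV; apply: (QM) => //.
have [->|neq] := eqVneq (p x) x; first by rewrite tperm1.
apply: Qt => /=; first by lia.
by rewrite ltn_neqAle pxx andbT eq_sym.
Qed.

(* In (v, p), the integer v (i, j) is the signed number of crossings of the
   strands starting at i and j. *)
Definition link_perm (n : nat) : Type := ({ffun 'I_n * 'I_n -> int} * 'S_n)%type.
HB.instance Definition _ n := Choice.on (link_perm n).

Definition permpair n (p : 'S_n) (x : 'I_n * 'I_n) := (p x.1, p x.2).

Section LinkPerm.
Variable n : nat.
Implicit Types x y z : link_perm n.

Local Open Scope ring_scope.
(** The strands starting at [i] and [j] enter the second factor at their images under the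
    permutation of the first. *)
Definition link_mul x y : link_perm n :=
  ([ffun q => x.1 q + y.1 (permpair x.2 q)], (x.2 * y.2)%g).
Definition link_one : link_perm n := ([ffun=> 0], 1%g).
Definition link_inv x : link_perm n :=
  ([ffun q => - x.1 (permpair x.2^-1%g q)], x.2^-1%g).

Fact link_mulA : associative link_mul.
Proof.
move=> x y z; congr pair; last exact: mulgA.
by apply/ffunP => q; rewrite !ffunE /permpair /= !permM GRing.addrA.
Qed.

Fact link_mul1 : left_id link_one link_mul.
Proof.
move=> [v p]; congr pair; last exact: mul1g.
by apply/ffunP => -[i j]; rewrite !ffunE /permpair /= !perm1 GRing.add0r.
Qed.

Fact link_mulr1 : right_id link_one link_mul.
Proof.
move=> [v p]; congr pair; last exact: mulg1.
by apply/ffunP => -[i j]; rewrite !ffunE /permpair /= GRing.addr0.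
Qed.

Fact link_mulV : left_inverse link_one link_inv link_mul.
Proof.
move=> [v p]; congr pair; last exact: mulVg.
by apply/ffunP => -[i j]; rewrite !ffunE /permpair /= GRing.addNr.
Qed.

Fact link_mulVr : right_inverse link_one link_inv link_mul.
Proof.
move=> [v p]; congr pair; last exact: mulgV.
by apply/ffunP => -[i j]; rewrite !ffunE /permpair /= !permK GRing.addrN.
Qed.

HB.instance Definition _ :=
  isGroup.Build (link_perm n) link_mulA link_mul1 link_mulr1 link_mulV link_mulVr.

Definition link x (i j : 'I_n) : int := x.1 (i, j).
Definition lperm x : 'S_n := x.2.

Lemma link_permP x y : lperm x = lperm y -> (forall i j, link x i j = link y i j) -> x = y.
Proof.
case: x y => [u p] [v q]; rewrite /lperm /= => -> uv; congr pair.
by apply/ffunP => -[i j]; exact: uv.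
Qed.

Lemma linkM x y i j : link (x * y)%g i j = link x i j + link y (lperm x i) (lperm x j).
Proof. by rewrite /link /= ffunE. Qed.

Lemma link1 i j : link 1%g i j = 0.
Proof. by rewrite /link /= ffunE. Qed.

Lemma linkV x i j : link (x^-1)%g i j = - link x ((lperm x)^-1%g i) ((lperm x)^-1%g j).
Proof. by rewrite /link /= ffunE. Qed.

Lemma lpermM : {morph lperm : x y / (x * y)%g}.
Proof. by []. Qed.

HB.instance Definition _ := isMultiplicative.Build (link_perm n) 'S_n lperm lpermM.

Lemma lpermV x : lperm x^-1%g = (lperm x)^-1%g. Proof. by []. Qed.

Lemma linkJ x y i j : lperm x = 1%g ->
  link (x ^ y)%g i j = link x ((lperm y)^-1%g i) ((lperm y)^-1%g j).
Proof.
by move=> x1; rewrite conjgE !linkM linkV x1 !perm1 lpermV; lia.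
Qed.

Definition crossing (a b : 'I_n) : link_perm n :=
  ([ffun q => ((q == (a, b)) || (q == (b, a)))%:R], tperm a b).

Lemma link_crossing a b i j :
  link (crossing a b) i j = ((i == a) && (j == b) || (i == b) && (j == a))%:R.
Proof. by rewrite /link ffunE. Qed.

Lemma lperm_crossing a b : lperm (crossing a b) = tperm a b.
Proof. by []. Qed.

End LinkPerm.

Section CrossingRelations.
Variable n : nat.
Implicit Types a b c d i j : 'I_n.

Lemma tperm_eq a b i j : (tperm a b i == j) = (i == tperm a b j).
Proof. by rewrite (can2_eq (tpermK a b) (tpermK a b)). Qed.

Lemma crossingC a b c d : a != c -> a != d -> b != c -> b != d ->
  crossing a b * crossing c d = crossing c d * crossing a b.
Proof.
move=> ac ad bc bd; apply: link_permP => [|i j].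
  apply: (@mulgI _ (tperm c d)^-1); rewrite !lpermM !lperm_crossing mulKg -conjgE.
  by rewrite tpermJ !tpermD // eq_sym.
rewrite !linkM !link_crossing !lperm_crossing !tperm_eq.
have abD : (tperm a b c = c) * (tperm a b d = d) by rewrite !tpermD.
have cdD : (tperm c d a = a) * (tperm c d b = b) by rewrite !tpermD // eq_sym.
by rewrite !(abD, cdD) GRing.addrC.
Qed.

(** On either side each two of the three strands cross exactly once. *)
Lemma crossingB a b c : a != b -> a != c -> b != c ->
  crossing b c * (crossing a b * crossing b c) =
  crossing a b * (crossing b c * crossing a b).
Proof.
move=> ab ac bc; apply: link_permP => [|i j].
  rewrite !lpermM !lperm_crossing.
  have J x y p : tperm x y * (p * tperm x y) = p ^ tperm x y by rewrite conjgE tpermV.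
  by rewrite !J !tpermJ tpermL tpermR !tpermD // eq_sym.
rewrite !linkM !link_crossing !lperm_crossing !tperm_eq.
have bca : tperm b c a = a by rewrite tpermD // eq_sym.
have abc : tperm a b c = c by rewrite tpermD.
by rewrite !(tpermL, tpermR, bca, abc); lia.
Qed.
End CrossingRelations.

Definition strand_crossing n (i : 'I_n.-1) := crossing (strand_l i) (strand_r i).

Fact artin_rel_crossing n u v : artin_rel u v ->
  eval_word (@strand_crossing n) u = eval_word (@strand_crossing n) v.
Proof.
case=> {u v} i j ij; rewrite /eval_word !big_cat !big_seq1 /eval_letter /=.
  by apply: crossingC; rewrite -val_eqE /=; lia.
rewrite /strand_crossing (_ : strand_l j = strand_r i); last exact: val_inj.
by apply: crossingB; rewrite -val_eqE /=; lia.
Qed.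

Definition braid_link n : {multiplicative braid_group n -> link_perm n} :=
  pres_lift (@artin_rel_crossing n).

Lemma lperm_eval_word n (w : word 'I_n.-1) :
  lperm (eval_word (@strand_crossing n) w) = eval_word (@adj_transp n) w.
Proof.
rewrite /eval_word; elim: w => [|l w IH]; first by rewrite !big_nil.
by rewrite !big_cons lpermM IH /eval_letter; case: ifP.
Qed.

Lemma lperm_braid_link n x : lperm (braid_link n x) = braid_perm n x.
Proof. exact: lperm_eval_word. Qed.

Lemma pure_link_comm n (x y : link_perm n) :
  lperm x = 1 -> lperm y = 1 -> x * y = y * x.
Proof.
move=> x1 y1; apply: link_permP => [|i j]; first by rewrite !lpermM x1 y1.
by rewrite !linkM x1 y1 !perm1 GRing.addrC.
Qed.

(** * Morphisms from quotient groups, and abelian normal subgroups written additively *)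

Section QuotLift.
Variables (G H : groupType) (N : normal_subgroup G) (f : {multiplicative G -> H}).

Definition quot_lift of (forall x, N x -> f x = 1) : quot N -> H :=
  fun x => f (repr x).

Hypothesis fN : forall x, N x -> f x = 1.

Lemma quot_liftE x : quot_lift fN (\pi_(quot N)%qT x) = f x.
Proof.
have := fN (quot_reprK N x); rewrite gmulfM multV => /mulg1_eq.
by rewrite invgK.
Qed.

Lemma pi_quotM x y :
  \pi_(quot N)%qT (x * y) = \pi_(quot N)%qT x * \pi_(quot N)%qT y.
Proof. by rewrite -quot_mulE. Qed.

Lemma pi_quotV x : \pi_(quot N)%qT x^-1 = (\pi_(quot N)%qT x)^-1.
Proof. by rewrite -quot_invE. Qed.

Lemma pi_quot_eq1 x : \pi_(quot N)%qT x = 1 <-> N x.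
Proof.
have := Defs.quotP N 1 x; rewrite invg1 mul1g => -[to_eq of_eq].
by split=> [/esym /of_eq|/to_eq /esym].
Qed.

Fact quot_liftM : {morph quot_lift fN : x y / x * y}.
Proof.
move=> x y; rewrite -[x]reprK -[y]reprK -pi_quotM !quot_liftE; exact: gmulfM.
Qed.
End QuotLift.

HB.instance Definition _ (G H : groupType) (N : normal_subgroup G)
  (f : {multiplicative G -> H}) (fN : forall x, N x -> f x = 1) :=
  isMultiplicative.Build (quot N) H (quot_lift fN) (quot_liftM fN).

Section AbelianSubgroup.
Variables (G : groupType) (A : normal_subgroup G).

(* The commutation proof is an argument so that the Z-module structure can be
   attached to the type itself. *)
Definition additive_sub of (forall x y, A x -> A y -> x * y = y * x) :=
  {x : G | `[< A x >]}.

Hypothesis abA : forall x y, A x -> A y -> x * y = y * x.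

HB.instance Definition _ := SubChoice.on (additive_sub abA).
Implicit Types x y z : additive_sub abA.

Lemma additive_subP x : A (val x).
Proof. by case: x => y /= /asboolP. Qed.

Definition additive_in (x : G) (Ax : A x) : additive_sub abA :=
  exist _ x (asboolT Ax).

Definition asub_add x y := additive_in (Defs.normalM (additive_subP x) (additive_subP y)).
Definition asub_opp x := additive_in (Defs.normalV (additive_subP x)).
Definition asub_zero := additive_in (Defs.normal1 A).

Fact asub_addA : associative asub_add.
Proof. by move=> x y z; apply: val_inj; exact: mulgA. Qed.
Fact asub_addC : commutative asub_add.
Proof. by move=> x y; apply: val_inj; apply: abA; exact: additive_subP. Qed.
Fact asub_add0 : left_id asub_zero asub_add.
Proof. by move=> x; apply: val_inj; exact: mul1g. Qed.
Fact asub_addN : left_inverse asub_zero asub_opp asub_add.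
Proof. by move=> x; apply: val_inj; exact: mulVg. Qed.

HB.instance Definition _ :=
  GRing.isZmodule.Build (additive_sub abA) asub_addA asub_addC asub_add0 asub_addN.

Definition asub_conj (g : G) x := additive_in (Defs.normalJ g (additive_subP x)).

Fact asub_conjB g : {morph asub_conj g : x y / (x - y)%R}.
Proof. by move=> x y; apply: val_inj; rewrite /= -conjVg -conjMg. Qed.

HB.instance Definition _ g :=
  GRing.isZmodMorphism.Build (additive_sub abA) (additive_sub abA) (asub_conj g)
    (@asub_conjB g).
End AbelianSubgroup.

(** * Faithfulness of the linking numbers *)

Lemma conjg_comm (G : groupType) (x y : G) : x * y = y * x -> x ^ y = x.
Proof. by move=> xy; rewrite conjgE xy mulKg. Qed.

Section LinkFaithful.
Variables (N : nat) (G : groupType).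
Variables (phi : {multiplicative G -> link_perm N.+1}) (s : nat -> G).
Hypothesis N_gt0 : (0 < N)%N.
Hypothesis gen_ind : forall P : G -> Prop, P 1 ->
  (forall x i, (i < N)%N -> P x -> P (x * s i)) ->
  (forall x i, (i < N)%N -> P x -> P (x * (s i)^-1)) -> forall x, P x.
Hypothesis phi_s : forall i, (i < N)%N -> phi (s i) = crossing (inord i) (inord i.+1).
Hypothesis sC : forall i j, (i.+1 < j)%N -> (j < N)%N -> s i * s j = s j * s i.
Hypothesis sB : forall i, (i.+1 < N)%N ->
  s i.+1 * (s i * s i.+1) = s i * (s i.+1 * s i).

Definition gperm : {multiplicative G -> 'S_N.+1} := @lperm N.+1 \o phi.
Arguments gperm : simpl never.

Definition pure := kernel gperm.

Hypothesis pureC : forall x y, pure x -> pure y -> x * y = y * x.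

Let o0 : 'I_N.+1 := inord 0.
Let o1 : 'I_N.+1 := inord 1.

Lemma gperm_s i : (i < N)%N -> gperm (s i) = nat_transp N i.
Proof. by move=> iN; rewrite /gperm /= phi_s. Qed.

Lemma gperm_surj p : exists x, gperm x = p.
Proof.
apply: (@transp_ind N (fun p => exists x, gperm x = p) 0) => //.
- by exists 1; exact: mult1.
- by move=> _ _ [x <-] [y <-]; exists (x * y); exact: gmulfM.
- by move=> i iN; exists (s i); apply: gperm_s; lia.
Qed.

(** The full twist of the first two strands, usually written $A_{12}$. *)
Definition twist := s 0 * s 0.

Lemma pureP x : pure x <-> gperm x = 1.
Proof. by []. Qed.

Lemma square_pure i : (i < N)%N -> pure (s i * s i).
Proof. by move=> iN; apply/pureP; rewrite gmulfM gperm_s // tperm2. Qed.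

Lemma pure_conj x y : pure x -> pure y -> x ^ y = x.
Proof. by move=> px py; rewrite conjgE (pureC px py) mulKg. Qed.

(** Since [pure] is abelian, conjugation on it factors through the permutations. *)
Lemma conj_gperm x g h : pure x -> gperm g = gperm h -> x ^ g = x ^ h.
Proof.
move=> px gh; rewrite -[in LHS](mulgVK h g) conjgM; congr (_ ^ h).
by apply: pure_conj => //; apply/pureP; rewrite gmulfM multV gh mulgV.
Qed.

Lemma twist_pure : pure twist. Proof. exact: square_pure. Qed.

Lemma o0_neq1 : o0 != o1. Proof. by rewrite inord_inj. Qed.

(** By [conj_gperm], [g] can be replaced by a product of generators [s i] with [i >= 2], which
    commute with [s 0]. *)
Lemma twist_fix g : gperm g o0 = o0 -> gperm g o1 = o1 -> twist ^ g = twist.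
Proof.
move=> g0 g1; pose Q p := exists2 x, gperm x = p & twist ^ x = twist.
suff [x xg xt] : Q (gperm g) by rewrite -(conj_gperm twist_pure xg).
apply: (@transp_ind N Q 2).
- by exists 1; rewrite ?conjg1 //; exact: mult1.
- move=> _ _ [x <- xt] [y <- yt]; exists (x * y); first exact: gmulfM.
  by rewrite conjgM xt.
- move=> i iN; exists (s i); first by apply: gperm_s; lia.
  have s0i : s 0 * s i = s i * s 0 by apply: sC; lia.
  by apply: conjg_comm; rewrite /twist -mulgA s0i mulgA s0i mulgA.
move=> i i2; suff: i = o0 \/ i = o1 by case=> ->.
by case: (posnP i) => ?; [left|right]; apply: val_inj; rewrite /= inordK //; lia.
Qed.

Lemma twist_conj g h :
  gperm g o0 = gperm h o0 -> gperm g o1 = gperm h o1 -> twist ^ g = twist ^ h.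
Proof.
move=> gh0 gh1; rewrite -[in LHS](mulgVK h g) conjgM twist_fix //.
  by rewrite gmulfM multV permM gh0 permK.
by rewrite gmulfM multV permM gh1 permK.
Qed.

Lemma gperm_2trans i j : i != j -> exists g, gperm g o0 = i /\ gperm g o1 = j.
Proof.
move=> ij; have [g gE] := gperm_surj (tperm o0 i * tperm (tperm o0 i o1) j).
have i1 : tperm o0 i o1 != i by rewrite tperm_eq tpermR eq_sym o0_neq1.
by exists g; rewrite gE !permM !tpermL [tperm _ j i]tpermD // eq_sym.
Qed.

(** The class of the pure braid generator $A_{ij}$. By [twist_conj] the choice of [g] does not
    matter, and by [gperm_2trans] the default 1 occurs only for [i = j]. *)
Definition pure_gen i j : G :=
  if pselect (exists g, gperm g o0 = i /\ gperm g o1 = j) is left ex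
  then twist ^ (projT1 (cid ex)) else 1.

Lemma pure_gen_conj g : pure_gen (gperm g o0) (gperm g o1) = twist ^ g.
Proof.
rewrite /pure_gen; case: pselect => [ex|[]]; last by exists g.
by case: cid => h /= [h0 h1]; apply: twist_conj.
Qed.

Lemma pure_gen_diag i : pure_gen i i = 1.
Proof.
rewrite /pure_gen; case: pselect => // ex; case: {-}(ex) => g [gi gj].
by have := o0_neq1; rewrite -(inj_eq (@perm_inj _ (gperm g))) gi gj eqxx.
Qed.

Lemma pure_gen_pure i j : pure (pure_gen i j).
Proof.
rewrite /pure_gen; case: pselect => [ex|_]; last exact: Defs.normal1.
by apply: Defs.normalJ; exact: twist_pure.
Qed.

Lemma pure_genJ i j g : pure_gen i j ^ g = pure_gen (gperm g i) (gperm g j).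
Proof.
have [->|/gperm_2trans[h [<- <-]]] := eqVneq i j; first by rewrite !pure_gen_diag conj1g.
by rewrite -!permM -gmulfM !pure_gen_conj conjgM.
Qed.

(** [s 0] commutes with its square and exchanges the first two strands. *)
Lemma pure_gen_sym i j : pure_gen i j = pure_gen j i.
Proof.
have [-> //|/gperm_2trans[h [<- <-]]] := eqVneq i j.
rewrite pure_gen_conj -[twist in LHS](_ : twist ^ s 0 = _); last first.
  by rewrite /twist conjgE mulgA mulKg.
rewrite -conjgM -pure_gen_conj gmulfM !permM gperm_s // /nat_transp.
by rewrite tpermL tpermR.
Qed.

(** By the braid relation, [s i.+1 * s i] conjugates [s i] to [s i.+1], so all these squares are
    conjugates of [twist]. *)
Lemma square_gen i : (i < N)%N -> exists p q, s i * s i = pure_gen p q.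
Proof.
elim: i => [|i IH] iN.
  by exists (gperm 1 o0), (gperm 1 o1); rewrite pure_gen_conj conjg1.
have [p [q e]] := IH (ltnW iN); pose x := s i.+1 * s i.
exists (gperm x p), (gperm x q); rewrite -pure_genJ -e conjMg.
suff -> : s i ^ x = s i.+1 by [].
by rewrite conjgE /x -sB // (mulgA (s i.+1)) mulKg.
Qed.

Lemma link_pure_gen i j x y : i != j ->
  link (phi (pure_gen i j)) x y =
  (2 * ((x == i) && (y == j) || (x == j) && (y == i))%:R)%R.
Proof.
case/gperm_2trans=> [g [<- <-]]; rewrite pure_gen_conj !gmulfM multV -conjgE.
rewrite linkJ; last by rewrite -gmulfM; exact: twist_pure.
rewrite linkM !phi_s // !link_crossing lperm_crossing !tperm_eq tpermL tpermR.
have gE z w : ((lperm (phi g))^-1 z == w) = (z == gperm g w).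
  by rewrite -(inj_eq (@perm_inj _ (gperm g))) permKV.
by rewrite !gE -!/o0 -!/o1; move: (_ && _) (_ && _) => [] [].
Qed.

Local Notation pure_ab := (additive_sub pureC).

Definition pgen (q : 'I_N.+1 * 'I_N.+1) : pure_ab :=
  additive_in pureC (pure_gen_pure q.1 q.2).

(** The pairs are ordered, so by [pure_gen_sym] the coefficients [v (i, j)] and [v (j, i)] belong to
    the same generator. *)
Definition pure_sum (v : 'I_N.+1 * 'I_N.+1 -> int) : pure_ab := (\sum_q pgen q *~ v q)%R.

Lemma pgenJ g q : asub_conj g (pgen q) = pgen (permpair (gperm g) q).
Proof. by apply: val_inj; exact: pure_genJ. Qed.

Lemma pure_sumJ g v : asub_conj g (pure_sum v) = pure_sum (v \o permpair (gperm g)^-1).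
Proof.
rewrite /pure_sum raddf_sum.
have pK : cancel (permpair (gperm g)^-1) (permpair (gperm g)).
  by case=> i j; rewrite /permpair /= !permKV.
rewrite (reindex_inj (can_inj pK)); apply: eq_bigr => q _.
by rewrite raddfMz [X in (X *~ _)%R](pgenJ g) pK.
Qed.

Lemma pure_sumB u v : pure_sum (fun q => u q - v q)%R = (pure_sum u - pure_sum v)%R.
Proof. by rewrite /pure_sum -sumrB; apply: eq_bigr => q _; rewrite mulrzBr. Qed.

Lemma pure_span_subgroup : is_subgroup [set x | exists v, x = val (pure_sum v)].
Proof.
split; first by exists (fun=> 0%R); rewrite /pure_sum big1.
by move=> _ _ [u ->] [v ->]; exists (fun q => u q - v q)%R; rewrite pure_sumB.
Qed.

Lemma pure_span_conj x g : (exists v, x = val (pure_sum v)) ->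
  exists v, x ^ g = val (pure_sum v).
Proof.
by move=> [v ->]; exists (v \o permpair (gperm g)^-1); rewrite -pure_sumJ.
Qed.

Definition pure_span := NormalSubgroup pure_span_subgroup pure_span_conj.

Lemma pure_gen_span i j : pure_span (pure_gen i j).
Proof.
pose v q : int := (q == (i, j))%:R%R; exists v.
suff -> : pure_sum v = pgen (i, j) by [].
rewrite /pure_sum /v (bigD1 (i, j)) // eqxx mulr1z.
by rewrite big1 => [|q /negbTE ->]; [exact: addr0 | exact: mulr0z].
Qed.

(** Modulo [pure_span] the generators become involutions and satisfy the Coxeter relations. A pure
    element has trivial permutation, so [coxeter_presentation] makes it trivial in this quotient. *)
Lemma pure_spanP x : pure x -> pure_span x.
Proof.
pose t i := \pi_(quot pure_span)%qT (s i).
have tt i : (i < N)%N -> t i * t i = 1.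
  move=> iN; rewrite -pi_quotM; apply/pi_quot_eq1.
  by have [p [q ->]] := square_gen iN; exact: pure_gen_span.
have tC i j : (i.+1 < j)%N -> (j < N)%N -> t i * t j = t j * t i.
  by move=> ij jN; rewrite -!pi_quotM sC.
have tB i : (i.+1 < N)%N -> t i.+1 * (t i * t i.+1) = t i * (t i.+1 * t i).
  by move=> iN; rewrite /t -!pi_quotM sB.
(* Inverse letters are replaced by the letters themselves, which agree with them both in the
   quotient and as transpositions. *)
have [w [wN xw gw]] : exists w, [/\ all (fun j => j < N)%N w,
    \pi_(quot pure_span)%qT x = word_prod t w & gperm x = word_prod (nat_transp N) w].
  apply: (gen_ind (P := fun x => exists w, [/\ all (fun j => j < N)%N w,
    \pi_(quot pure_span)%qT x = word_prod t w & gperm x = word_prod (nat_transp N) w])).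
  - by exists [::]; rewrite /word_prod !big_nil; split=> //; exact: mult1.
  - move=> y i iN [w [wN yw gw]]; exists (rcons w i).
    by rewrite all_rcons iN wN !word_prod_rcons pi_quotM yw gmulfM gperm_s // gw.
  move=> y i iN [w [wN yw gw]]; exists (rcons w i).
  rewrite all_rcons iN wN !word_prod_rcons pi_quotM pi_quotV yw.
  rewrite gmulfM multV gperm_s // gw.
  by rewrite tpermV (mulg1_eq (tt i iN)).
move=> px; apply/pi_quot_eq1; rewrite xw; apply: coxeter_presentation tt tC tB _ wN _.
by rewrite -gw.
Qed.

Definition pure_link i j (x : pure_ab) : int := link (phi (val x)) i j.

Fact pure_linkB i j : {morph pure_link i j : x y / (x - y)%R}.
Proof.
move=> x y; rewrite /pure_link /= gmulfM multV linkM linkV.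
rewrite (additive_subP x : lperm (phi (val x)) = 1).
by rewrite (additive_subP y : lperm (phi (val y)) = 1) invg1 !perm1.
Qed.

HB.instance Definition _ i j :=
  GRing.isZmodMorphism.Build pure_ab int (pure_link i j) (@pure_linkB i j).

Lemma pure_link_gen i j q : pure_link i j (pgen q) =
  ((q.1 != q.2)%:R * 2 * (((i, j) == q) || ((j, i) == q))%:R)%R.
Proof.
rewrite /pure_link /=; case: q => a b /=; rewrite !xpair_eqE.
have [->|ab] := eqVneq a b; last first.
  by rewrite link_pure_gen // mul1r (andbC (j == a)).
by rewrite pure_gen_diag mult1 link1 !mul0r.
Qed.

Lemma pure_link_sum i j v : i != j ->
  pure_link i j (pure_sum v) = (2 * (v (i, j) + v (j, i)))%R.
Proof.
move=> ij; rewrite /pure_sum raddf_sum (bigD1 (i, j)) // (bigD1 (j, i)) /=; last first.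
  by rewrite xpair_eqE eq_sym (negbTE ij).
rewrite big1 ?addr0 => [|q /andP[q1 q2]]; rewrite !raddfMz /= pure_link_gen.
  rewrite pure_link_gen /= (eq_sym j i) ij !eqxx orbT /=.
  by rewrite !mul1r !mulr1 !mulrzz mulrDr.
by rewrite (eq_sym (i, j)) (negbTE q1) (eq_sym (j, i)) (negbTE q2) mulr0 mul0rz.
Qed.

Lemma pure_link_diag i v : pure_link i i (pure_sum v) = 0%R.
Proof.
rewrite /pure_sum raddf_sum big1 // => -[a b] _; rewrite raddfMz /= pure_link_gen /=.
have [ab|ab] := boolP (_ || _); rewrite ?mulr0 ?mul0rz //.
suff -> : a != b = false by rewrite !mul0r mul0rz.
by apply/negbF; move: ab; rewrite orbb => /eqP[<- <-].
Qed.

Lemma pure_sum_eq0 v : (forall i j, i != j -> v (i, j) + v (j, i) = 0)%R ->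
  pure_sum v = 0%R.
Proof.
(* The sum splits into the pairs above, below and on the diagonal; exchanging the coordinates pairs
   the first two parts off. *)
move=> v0; rewrite /pure_sum (bigID (fun q : 'I_N.+1 * 'I_N.+1 => q.1 < q.2)%N) /=.
rewrite [X in (_ + X)%R](bigID (fun q : 'I_N.+1 * 'I_N.+1 => q.2 < q.1)%N) /=.
rewrite [X in (_ + (_ + X))%R]big1 ?addr0; last first.
  move=> -[i j] /=; rewrite -leqNgt -leqNgt => /andP[ji ij].
  have -> : i = j by apply/val_inj/eqP; rewrite eqn_leq ij ji.
  have -> : pgen (j, j) = 0%R by apply: val_inj; exact: pure_gen_diag.
  by rewrite mul0rz.
have tK : involutive (fun q : 'I_N.+1 * 'I_N.+1 => (q.2, q.1)) by case.
rewrite [X in (_ + X)%R](reindex_inj (inv_inj tK)) /=.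
rewrite [X in (_ + X)%R](eq_bigl (fun q : 'I_N.+1 * 'I_N.+1 => q.1 < q.2)%N); last first.
  by move=> q /=; case: ltngtP.
rewrite -big_split big1 //= => -[i j] /= ij.
have -> : pgen (j, i) = pgen (i, j) by apply: val_inj; exact: pure_gen_sym.
by rewrite -mulrzDr v0 ?mulr0z // neq_ltn ij.
Qed.

(** An element of the kernel is pure, hence some [pure_sum v]; its linking numbers
    [2 * (v (i, j) + v (j, i))] vanish, which forces the sum to be 0. *)
Lemma link_faithful : injective phi.
Proof.
move=> x y xy; apply: divg1_eq.
have xy1 : phi (x / y) = 1 by rewrite gmulfM multV xy mulgV.
have pxy : pure (x / y) by apply/pureP; rewrite /gperm /= xy1.
have [v ev] := pure_spanP pxy; rewrite ev pure_sum_eq0 // => i j ij.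
have := pure_link_sum v ij; rewrite /pure_link -ev xy1 link1; lia.
Qed.

Lemma pure_link_even x : pure x -> exists b : 'I_N.+1 -> 'I_N.+1 -> int,
  [/\ forall i j, b i j = b j i, forall i, b i i = 0%R &
      forall i j, link (phi x) i j = (2 * b i j)%R].
Proof.
move=> /pure_spanP[v ->].
(* The coefficients [v (i, i)] are arbitrary, so the diagonal is set to 0 by hand. *)
exists (fun i j => if i == j then 0 else v (i, j) + v (j, i))%R; split=> [i j|i|i j].
- by rewrite eq_sym addrC.
- by rewrite eqxx.
have [->|ij] := eqVneq i j; last exact: pure_link_sum.
by rewrite mulr0; exact: pure_link_diag.
Qed.

Lemma pure_link_surj (b : 'I_N.+1 -> 'I_N.+1 -> int) :
  (forall i j, b i j = b j i) -> (forall i, b i i = 0%R) ->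
  exists2 x, pure x & forall i j, link (phi x) i j = (2 * b i j)%R.
Proof.
move=> bC b0.
(* Restricting to [i < j] counts each unordered pair once. *)
pose v (q : 'I_N.+1 * 'I_N.+1) := (if q.1 < q.2 then b q.1 q.2 else 0%R)%N.
exists (val (pure_sum v)) => [|i j]; first exact: additive_subP.
have [->|ij] := eqVneq i j; first by rewrite b0 mulr0; exact: pure_link_diag.
rewrite [LHS](pure_link_sum v ij) /v /=.
case: ltngtP => [_|_|/val_inj e]; rewrite ?addr0 ?add0r //; first by rewrite bC.
by rewrite e eqxx in ij.
Qed.
End LinkFaithful.
Arguments gperm {N G} phi : simpl never.

(** * The groups B_n/[P_n, P_n] *)

Fact braid_link_derived n x : derived (pure_braid n) x -> braid_link n x = 1.
Proof.
move=> Dx; apply: (Dx (kernel (braid_link n))); first exact: normal_subgroupP.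
move=> _ [y [z [py pz ->]]].
have /(congr1 (fun u => (braid_link n (z * y))^-1 * u)) :
    braid_link n y * braid_link n z = braid_link n z * braid_link n y.
  by apply: pure_link_comm; rewrite lperm_braid_link.
rewrite -!gmulfM mulVg => yz; rewrite /= -[RHS]yz -multV -gmulfM.
by rewrite /commg conjgE invgM !mulgA.
Qed.

(** For [n >= 3] this is a crystallographic group with holonomy group $S_n$, whence the name. *)
Definition crystal_group n := quot (derived (pure_braid n)).

Definition crystal_link n : {multiplicative crystal_group n -> link_perm n} :=
  quot_lift (@braid_link_derived n).

Arguments crystal_link : simpl never.

Section CrystalGroup.
Variable m : nat.

(** Natural indices fit the sequences [s] above; [inord] sends those beyond [m] to 0, hence the
    bounds in the lemmas below. *)
Definition crystal_gen (i : nat) : crystal_group m.+2 :=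
  \pi_(crystal_group m.+2)%qT (pres_gen _ (inord i : 'I_m.+1)).

Lemma crystal_gen_ind (P : crystal_group m.+2 -> Prop) : P 1 ->
  (forall x i, (i < m.+1)%N -> P x -> P (x * crystal_gen i)) ->
  (forall x i, (i < m.+1)%N -> P x -> P (x * (crystal_gen i)^-1)) -> forall x, P x.
Proof.
move=> P1 PM PV x; rewrite -[x]reprK -[repr x]reprK.
elim/last_ind: (repr (repr x)) => [|w [i b] IH]; first exact: P1.
rewrite -cats1 -pres_mulE pi_quotM.
rewrite -[i]inord_val; case: b; last by apply: PM.
rewrite -[[:: _]]/(winv (gen (inord i))) -pres_invE pi_quotV.
exact: PV.
Qed.

Lemma crystal_link_gen i : (i < m.+1)%N ->
  crystal_link m.+2 (crystal_gen i) = crossing (inord i) (inord i.+1).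
Proof.
move=> im; rewrite [LHS]quot_liftE [LHS]pres_lift_gen /strand_crossing.
by congr crossing; apply: val_inj; rewrite /= !inordK //; lia.
Qed.

Lemma crystal_genC i j : (i.+1 < j)%N -> (j < m.+1)%N ->
  crystal_gen i * crystal_gen j = crystal_gen j * crystal_gen i.
Proof.
move=> ij jm; rewrite -!pi_quotM; congr (\pi_(_)%qT _).
have mulE (a b : 'I_m.+1) : pres_gen (@artin_rel m.+2) a * pres_gen _ b =
  \pi_(braid_group m.+2)%qT (gen a ++ gen b) by exact: pres_mulE.
rewrite !mulE; apply/presP; apply: PresRel; apply: (@ArtinComm m.+2).
rewrite !inordK //; lia.
Qed.

Lemma crystal_genB i : (i.+1 < m.+1)%N ->
  crystal_gen i.+1 * (crystal_gen i * crystal_gen i.+1) =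
  crystal_gen i * (crystal_gen i.+1 * crystal_gen i).
Proof.
move=> im; rewrite -[X in _ * X = _]pi_quotM -[X in _ = _ * X]pi_quotM.
rewrite -[LHS]pi_quotM -[RHS]pi_quotM; congr (\pi_(_)%qT _).
have mulE (a b c : 'I_m.+1) :
    pres_gen (@artin_rel m.+2) a * (pres_gen _ b * pres_gen _ c) =
    \pi_(braid_group m.+2)%qT (gen a ++ gen b ++ gen c).
  by rewrite [X in _ * X]pres_mulE [LHS]pres_mulE.
rewrite !mulE; apply/presP; apply: PresRel; apply: (@ArtinBraid m.+2).
by rewrite !inordK //; lia.
Qed.

Notation crystal_perm := (gperm (crystal_link m.+2)).

Lemma crystal_pureC x y : pure (crystal_link m.+2) x -> pure (crystal_link m.+2) y ->
  x * y = y * x.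
Proof.
have permE z : crystal_perm (\pi_(crystal_group m.+2)%qT z) = braid_perm _ z.
  by rewrite -lperm_braid_link; congr lperm; exact: quot_liftE.
rewrite -[x]reprK -[y]reprK => /pureP + /pureP; rewrite !permE => px py.
rewrite -!pi_quotM; apply/(Defs.quotP (derived (pure_braid m.+2))).
move=> H _ CH; apply: CH; exists (repr y), (repr x); split=> //.
by rewrite /commg conjgE invgM !mulgA.
Qed.

Lemma crystal_link_inj : injective (crystal_link m.+2).
Proof.
exact: (link_faithful (ltn0Sn m) crystal_gen_ind crystal_link_gen crystal_genC
  crystal_genB crystal_pureC).
Qed.

Lemma crystal_perm_surj p : exists x, crystal_perm x = p.
Proof. exact: (gperm_surj (ltn0Sn m) crystal_link_gen). Qed.

Lemma crystal_pure_even x : crystal_perm x = 1 -> exists b : 'I_m.+2 -> 'I_m.+2 -> int,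
  [/\ forall i j, b i j = b j i, forall i, b i i = 0%R &
      forall i j, link (crystal_link m.+2 x) i j = (2 * b i j)%R].
Proof.
exact: (pure_link_even (ltn0Sn m) crystal_gen_ind crystal_link_gen crystal_genC
  crystal_genB crystal_pureC).
Qed.

Lemma crystal_pure_surj (b : 'I_m.+2 -> 'I_m.+2 -> int) :
  (forall i j, b i j = b j i) -> (forall i, b i i = 0%R) ->
  exists2 x, crystal_perm x = 1 &
    forall i j, link (crystal_link m.+2 x) i j = (2 * b i j)%R.
Proof.
exact: (pure_link_surj (ltn0Sn m) crystal_link_gen crystal_genC crystal_pureC).
Qed.
End CrystalGroup.

(** * The Frobenius group of order 21 *)

Section FrobeniusPair.
Variable H : groupType.

Definition frob_pair (x y : H) := [/\ x ^+ 3 = 1, y ^+ 7 = 1 & x * y / x = y ^+ 2].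

Lemma eval_word_cat (X : choiceType) (f : X -> H) u v :
  eval_word f (u ++ v) = eval_word f u * eval_word f v.
Proof. by rewrite /eval_word big_cat. Qed.

Lemma eval_word_gen (X : choiceType) (f : X -> H) x : eval_word f (gen x) = f x.
Proof. by rewrite /eval_word big_seq1. Qed.

Lemma eval_word_exp (X : choiceType) (f : X -> H) w n :
  eval_word f (wexp w n) = eval_word f w ^+ n.
Proof.
elim: n => [|n IH]; first by rewrite /eval_word big_nil.
by rewrite expgS -IH -eval_word_cat.
Qed.

Lemma eval_word_inv (X : choiceType) (f : X -> H) w :
  eval_word f (winv w) = (eval_word f w)^-1.
Proof.
apply/esym/mulg1_eq; rewrite -eval_word_cat.
have := eval_pres_eq (R := fun _ _ => False) (f := f) _ (pres_eqV _ w).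
by rewrite [in RHS]/eval_word big_nil; apply.
Qed.

Lemma frobenius_relP (f : bool -> H) : frob_pair (f false) (f true) ->
  forall u v, frobenius_rel u v -> eval_word f u = eval_word f v.
Proof.
case=> s3 t7 st u v [].
- by rewrite eval_word_exp eval_word_gen s3 /eval_word big_nil.
- by rewrite eval_word_exp eval_word_gen t7 /eval_word big_nil.
- rewrite (eval_word_cat f frob_s) (eval_word_cat f frob_t).
  by rewrite eval_word_inv eval_word_exp !eval_word_gen mulgA.
Qed.

Lemma expg_modn (x : H) n a : x ^+ n = 1 -> x ^+ (a %% n)%N = x ^+ a.
Proof.
by move=> xn; rewrite [in RHS](divn_eq a n) expgnDr mulnC expgnA xn expg1n mul1g.
Qed.
End FrobeniusPair.

Lemma frob_pair_map (G H : groupType) (f : {multiplicative G -> H}) x y :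
  frob_pair x y -> frob_pair (f x) (f y).
Proof.
have fX z n : f (z ^+ n) = f z ^+ n.
  by elim: n => [|n IH]; rewrite ?mult1 // !expgS gmulfM IH.
by case=> x3 y7 xy; split; rewrite -?fX -?multV -?gmulfM ?x3 ?y7 ?xy ?mult1.
Qed.

Notation fs := (pres_gen frobenius_rel false : frobenius21).
Notation ft := (pres_gen frobenius_rel true : frobenius21).

Lemma frobenius_pair : frob_pair fs ft.
Proof.
have powE b n : (pres_gen frobenius_rel b : frobenius21) ^+ n =
    \pi_frobenius21%qT (wexp (gen b) n).
  by elim: n => [|n IH] //; rewrite expgS IH; exact: pres_mulE.
split; rewrite ?powE.
- by apply/presP/PresRel; exact: FrobS.
- by apply/presP/PresRel; exact: FrobT.
- rewrite -mulgA; transitivity (\pi_frobenius21%qT (frob_s ++ frob_t ++ winv frob_s)).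
    by rewrite -pres_mulE -pres_mulE -pres_invE.
  by apply/presP/PresRel; exact: FrobConj.
Qed.

(** The relation [fs * ft = ft ^+ 2 * fs] moves every [fs] to the right, and inverses are positive
    powers. This bounds the order by 21; that the 21 normal forms differ follows later from the
    action on pairs. *)
Lemma frobenius_elt (x : frobenius21) :
  exists a b, [/\ (a < 7)%N, (b < 3)%N & x = ft ^+ a * fs ^+ b].
Proof.
have [s3 t7 st] := frobenius_pair.
suff [a [b ->]] : exists a b, x = ft ^+ a * fs ^+ b.
  by exists (a %% 7)%N, (b %% 3)%N; rewrite !expg_modn // !ltn_pmod.
have sta a : fs * ft ^+ a = ft ^+ (2 * a) * fs.
  have st1 : fs * ft = ft ^+ 2 * fs by rewrite -st mulgVK.
  elim: a => [|a IH]; first by rewrite mulg1 mul1g.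
  by rewrite expgS mulgA st1 -mulgA IH mulgA -expgnDr; congr (_ ^+ _ * _); lia.
pose P y := exists a b, y = ft ^+ a * fs ^+ b.
have Ps y : P y -> P (fs * y).
  by case=> a [b ->]; exists (2 * a)%N, b.+1; rewrite mulgA sta -mulgA -expgS.
have Pt y : P y -> P (ft * y).
  by case=> a [b ->]; exists a.+1, b; rewrite mulgA -expgS.
have VE z n : z ^+ n.+1 = 1 -> (z^-1 : frobenius21) = z ^+ n.
  by move=> zn; apply: mulg1_eq; rewrite -expgS.
have PX z n y : (forall y, P y -> P (z * y)) -> P y -> P (z ^+ n * y).
  move=> Pz Py; elim: n => [|n IH]; first by rewrite mul1g.
  by rewrite expgS -mulgA; apply: Pz.
rewrite -[x]reprK; elim: (repr x) => [|[c b] w IH]; first by exists 0, 0; rewrite mulg1.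
rewrite -cat1s -pres_mulE.
have {}IH : P (\pi_frobenius21%qT w) := IH.
case: b; last by case: c; [apply: Pt | apply: Ps].
rewrite -[[:: _]]/(winv (gen c)) -pres_invE; case: c.
  have -> : pres_inv (\pi_frobenius21%qT (gen true)) = ft ^+ 6 by apply: VE.
  exact: PX.
have -> : pres_inv (\pi_frobenius21%qT (gen false)) = fs ^+ 2 by apply: VE.
exact: PX.
Qed.

(** * Computing permutations and crossing numbers of explicit braid words *)

Section WordComputation.
Implicit Types w : word nat.

(** These versions over [nat] can be evaluated by [vm_compute], unlike products in [link_perm]. *)
Definition swap_nat (k i : nat) : nat :=
  if i == k then k.+1 else if i == k.+1 then k else i.

Fixpoint word_perm w (i : nat) : nat :=
  if w is l :: w' then word_perm w' (swap_nat l.1 i) else i.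

Definition cross_sign (l : nat * bool) (i j : nat) : int :=
  if (i == l.1) && (j == l.1.+1) || (i == l.1.+1) && (j == l.1)
  then (if l.2 then -1 else 1)%R else 0%R.

Fixpoint word_link w (i j : nat) : int :=
  if w is l :: w' then
    (cross_sign l i j + word_link w' (swap_nat l.1 i) (swap_nat l.1 j))%R
  else 0%R.

Definition same_link N w w' :=
  all (fun i => (word_perm w i == word_perm w' i) &&
    all (fun j => word_link w i j == word_link w' i j) (iota 0 N)) (iota 0 N).

Variable m : nat.
Notation phi := (crystal_link m.+2).
Notation letters w := (all (fun l => l.1 < m.+1)%N w).

Lemma nat_transp_swap k (i : 'I_m.+2) : (k < m.+1)%N ->
  nat_transp m.+1 k i = swap_nat k i :> nat.
Proof. exact: nat_transpE. Qed.

Lemma eval_word_nil : eval_word (crystal_gen m) [::] = 1.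
Proof. exact: big_nil. Qed.

Lemma word_permE w (i : 'I_m.+2) : letters w ->
  gperm phi (eval_word (crystal_gen m) w) i = word_perm w i :> nat.
Proof.
elim: w i => [|[k b] w IH] i; first by rewrite eval_word_nil mult1 perm1.
case/andP; rewrite -[_.1]/k => km wm; rewrite -cat1s eval_word_cat gmulfM permM IH //.
rewrite -[RHS]/(word_perm w (swap_nat k i)); congr word_perm.
rewrite -nat_transp_swap // -(gperm_s (@crystal_link_gen m) km).
rewrite /eval_word big_seq1 /eval_letter; case: b => //.
by rewrite multV (gperm_s (@crystal_link_gen m) km) tpermV.
Qed.

Lemma word_linkE w (i j : 'I_m.+2) : letters w ->
  link (phi (eval_word (crystal_gen m) w)) i j = word_link w i j.
Proof.
elim: w i j => [|[k b] w IH] i j; first by rewrite eval_word_nil mult1 link1.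
case/andP; rewrite -[_.1]/k => km wm; rewrite -cat1s eval_word_cat gmulfM linkM IH //.
have kE (c : bool) (x : 'I_m.+2) :
    lperm (phi (eval_word (crystal_gen m) [:: (k, c)])) x = swap_nat k x :> nat.
  by rewrite -[RHS]/(word_perm [:: (k, c)] x) -word_permE // /= km.
rewrite !kE; congr (_ + _)%R; rewrite /eval_word big_seq1 /eval_letter.
have eqE (x : 'I_m.+2) c : (c < m.+2)%N -> (x == inord c) = (x == c :> nat).
  by move=> cm; rewrite -val_eqE /= inordK.
have -> : cross_sign (k, b) i j = (if b then - link (crossing (inord k) (inord k.+1)) i j
    else link (crossing (inord k) (inord k.+1)) i j)%R.
  rewrite link_crossing !eqE; [|lia..].
  by rewrite /cross_sign /=; case: ifP => _; case: b.
case: b; rewrite -[_.1]/k -[_.2]/_; last by rewrite crystal_link_gen.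
rewrite multV crystal_link_gen // linkV lperm_crossing tpermV !link_crossing.
by rewrite !tperm_eq tpermL tpermR orbC.
Qed.

(** Injectivity of [crystal_link] turns the word problem into a finite check. *)
Lemma same_link_eq w w' : letters w -> letters w' -> same_link m.+2 w w' ->
  eval_word (crystal_gen m) w = eval_word (crystal_gen m) w'.
Proof.
move=> wm wm' /allP ww'; apply: crystal_link_inj.
have mem (i : 'I_m.+2) : (i : nat) \in iota 0 m.+2 by rewrite mem_iota add0n ltn_ord.
apply: link_permP => [|i j].
  apply/permP => i; apply: val_inj.
  have /andP[/eqP e _] := ww' _ (mem i).
  by rewrite [LHS]word_permE // [RHS]word_permE.
have /andP[_ /allP/(_ _ (mem j))/eqP e] := ww' _ (mem i).
by rewrite !word_linkE.
Qed.
End WordComputation.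

(* The signs make the signed crossings cancel along each orbit of the
   permutations i |-> 4i and i |-> i+1 of Z/7. *)
Definition word_s : word nat :=
  [:: (1, false); (3, false); (2, true); (5, false); (4, true); (3, true)]%N.
Definition word_t : word nat :=
  [:: (5, false); (4, false); (3, true); (2, false); (1, true); (0, true)]%N.

Definition crystal_s := eval_word (crystal_gen 5) word_s.
Definition crystal_t := eval_word (crystal_gen 5) word_t.

Lemma crystal_frob_pair : frob_pair crystal_s crystal_t.
Proof.
have one : 1 = eval_word (crystal_gen 5) [::] by rewrite /eval_word big_nil.
split; rewrite ?one -?eval_word_inv -?eval_word_exp -?eval_word_cat.
all: by apply: same_link_eq; vm_compute.
Qed.

(** * Affine permutations of Z/7 and their action on pairs *)

Definition orbit_pair (a b : nat) : nat * nat :=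
  let i := (4 ^ b * a %% 7)%N in let j := (4 ^ b * a.+1 %% 7)%N in (minn i j, maxn i j).

(** [orbit_pair a b] is the image of {0,1} under [i |-> 4^b (i + a)], in increasing order. The
    powers 1, 4, 2 of 4 represent the nonzero residues up to sign, so the difference of the pair
    determines [b], and its position then determines [a]. *)
Lemma orbit_pair_inj a b a' b' : (a < 7)%N -> (b < 3)%N -> (a' < 7)%N -> (b' < 3)%N ->
  orbit_pair a b = orbit_pair a' b' -> a = a' /\ b = b'.
Proof.
pose L := [seq (a, b) | a <- iota 0 7, b <- iota 0 3].
pose same p q := (orbit_pair p.1 p.2 == orbit_pair q.1 q.2) ==> (p == q).
have /allP inj : all (fun p => all (same p) L) L by vm_compute.
have mem c d : (c < 7)%N -> (d < 3)%N -> (c, d) \in L.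
  by move=> c7 d3; apply: allpairs_f; rewrite mem_iota.
move=> a7 b3 a7' b3' e; have /allP injab := inj _ (mem a b a7 b3).
by have := injab _ (mem a' b' a7' b3'); rewrite /same e eqxx => /eqP[].
Qed.

Lemma orbit_pair_surj i j : (i < j < 7)%N ->
  exists a b, [/\ (a < 7)%N, (b < 3)%N & orbit_pair a b = (i, j)].
Proof.
pose hit i j a := has (fun b => orbit_pair a b == (i, j)) (iota 0 3).
have /allP surj :
    all (fun j => all (fun i => has (hit i j) (iota 0 7)) (iota 0 j)) (iota 0 7).
  by vm_compute.
move=> /andP[ij j7]; have /allP surjj : all (fun i => has (hit i j) (iota 0 7)) (iota 0 j).
  by apply: surj; rewrite mem_iota.
have /hasP[a a7 /hasP[b b3 /eqP e]] : has (hit i j) (iota 0 7).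
  by apply: surjj; rewrite mem_iota.
by exists a, b; move: a7 b3; rewrite !mem_iota.
Qed.

(** The factor is 4, the inverse of 2 modulo 7, because products act from left to right: so
    [p * q / p = q ^+ 2]. *)
Definition affine_pair (p q : 'S_7) :=
  (forall i, p i = (4 * i %% 7)%N :> nat) /\ (forall i, q i = (i.+1 %% 7)%N :> nat).

Lemma crystal_affine :
  affine_pair (gperm (crystal_link 7) crystal_s) (gperm (crystal_link 7) crystal_t).
Proof.
have mem (i : 'I_7) : (i : nat) \in iota 0 7 by rewrite mem_iota add0n ltn_ord.
split=> i; rewrite word_permE //; apply/eqP; move: (mem i); move: (i : nat).
  by apply/(@allP _ (fun k => word_perm word_s k == 4 * k %% 7)%N); vm_compute.
by apply/(@allP _ (fun k => word_perm word_t k == k.+1 %% 7)%N); vm_compute.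
Qed.

(** As 7 is prime, [j - i] is invertible modulo 7, so a fixed point of [q ^+ (j - i)] would be fixed
    by [q]. *)
Lemma expg_perm_inj (q : 'S_7) x i j : q ^+ 7 = 1 -> q x != x ->
  (i < 7)%N -> (j < 7)%N -> (q ^+ i) x = (q ^+ j) x -> i = j.
Proof.
move=> q7 qx; wlog ij : i j / (i < j)%N => [IH|] i7 j7 e.
  by case: (ltngtP i j) => // ij; [|apply/esym]; apply: IH.
have fixd : (q ^+ (j - i)) x = x.
  by apply: (@perm_inj _ (q ^+ i)); rewrite -permM -expgnDr subnK // ltnW.
have fixM n : (q ^+ ((j - i) * n)) x = x.
  elim: n => [|n IH]; first by rewrite muln0 perm1.
  by rewrite mulnS expgnDr permM fixd IH.
have qn n : (n %% 7 = 1)%N -> q ^+ n = q.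
  by move=> n1; rewrite -(expg_modn n q7) n1.
(* [n] is the inverse of [d] modulo 7, found by cases. *)
have [d [n [dE n1]]] : exists d n, (j - i = d)%N /\ (d * n %% 7 = 1)%N.
  have : (0 < j - i < 7)%N by lia.
  case: (j - i)%N => [//|[|[|[|[|[|[|d]]]]]]] // _;
  by [exists 1%N, 1%N | exists 2, 4 | exists 3, 5 | exists 4, 2 | exists 5, 3 | exists 6, 6].
by move: qx; rewrite -{1}(qn _ n1) -dE fixM eqxx.
Qed.

(** Here [q] is a 7-cycle and [p] has a fixed point [x]. Labelling [q ^+ i] of [x] by [i] turns [q]
    into the shift and [p] into halving, that is multiplication by 4. *)
Lemma frob_pair_affine (p q : 'S_7) : frob_pair p q -> q != 1 ->
  exists r, affine_pair (p ^ r) (q ^ r).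
Proof.
move=> [_ q7 pq] q1.
have pqn n x : p ((q ^+ (2 * n)) x) = (q ^+ n) (p x).
  have pq2 y : p ((q ^+ 2) y) = q (p y) by rewrite -!permM -pq mulgVK.
  elim: n x => [|n IH] x; first by rewrite !perm1.
  by rewrite mulnS addnC expgnDr permM pq2 IH -permM -expgSr.
have [y qy] : exists y, q y != y.
  apply/existsP; apply: contraR q1; rewrite negb_exists => /forallP fixq.
  by apply/eqP/permP => x; rewrite perm1; apply/eqP; have := fixq x; rewrite negbK.
have inj x : q x != x -> injective (fun i : 'I_7 => (q ^+ i) x).
  by move=> qx i j /(expg_perm_inj q7 qx (ltn_ord i) (ltn_ord j)) /val_inj.
have [g _ gK] := injF_bij (inj y qy).
(* 2c solves c + 4 z = z mod 7, which makes q^(2c) y a fixed point of p. *)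
pose c := g (p y); pose x := (q ^+ (2 * c)) y.
have px : p x = x by rewrite /x pqn -[p y]gK -permM -expgnDr addnn -mul2n.
have qx : q x != x.
  by rewrite /x -permM -expgSr expgS permM (inj_eq perm_inj).
pose h := perm (inj x qx).
have hE i : h i = (q ^+ i) x by rewrite permE.
have hmod n : h (inord (n %% 7)) = (q ^+ n) x.
  by rewrite hE inordK ?ltn_pmod // expg_modn.
have conjE (r : 'S_7) (i : 'I_7) n :
    r ((q ^+ i) x) = (q ^+ n) x -> (r ^ h^-1) i = (n %% 7)%N :> nat.
  move=> e; rewrite conjgE invgK !permM hE e -hmod permK inordK // ltn_pmod //.
exists h^-1; split=> i; apply: conjE.
  rewrite -[in LHS](expg_modn i q7).
  (* Writing the exponent as twice [4 * i] lets [pqn] halve it. *)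
  have -> : (i %% 7 = (2 * (4 * i)) %% 7)%N by rewrite mulnA -modnMml mul1n.
  by rewrite expg_modn // pqn px.
by rewrite -permM -expgSr.
Qed.

(** * Conjugacy of the Frobenius subgroups *)

Section FrobeniusConjugacy.
Variables (G : groupType) (phi : {multiplicative G -> link_perm 7}).
Hypothesis phi_inj : injective phi.
Hypothesis phi_surj : forall p, exists x, gperm phi x = p.
Hypothesis pure_even : forall x, gperm phi x = 1 -> exists b : 'I_7 -> 'I_7 -> int,
  [/\ forall i j, b i j = b j i, forall i, b i i = 0%R &
      forall i j, link (phi x) i j = (2 * b i j)%R].
Hypothesis pure_surj : forall b : 'I_7 -> 'I_7 -> int,
  (forall i j, b i j = b j i) -> (forall i, b i i = 0%R) ->
  exists2 x, gperm phi x = 1 & forall i j, link (phi x) i j = (2 * b i j)%R.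

Definition affine_morph (f : frobenius21 -> G) :=
  affine_pair (gperm phi (f fs)) (gperm phi (f ft)).

Let o0 : 'I_7 := inord 0.
Let o1 : 'I_7 := inord 1.

Section AffineMorphism.
Variable f : {multiplicative frobenius21 -> G}.
Hypothesis fA : affine_morph f.

Lemma affine_perm a b (i : 'I_7) :
  gperm phi (f (ft ^+ a * fs ^+ b)) i = (4 ^ b * (i + a) %% 7)%N :> nat.
Proof.
case: fA => sA tA; rewrite gmulfM gmulfM permM.
have tE (j : 'I_7) : gperm phi (f (ft ^+ a)) j = ((j + a) %% 7)%N :> nat.
  elim: a j => [|a IH] j; first by rewrite !mult1 perm1 addn0 modn_small.
  by rewrite expgS !gmulfM permM IH tA modnDml addSnnS.
elim: b => [|b IH]; first by rewrite !mult1 perm1 tE mul1n.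
by rewrite expgSr !gmulfM permM sA IH modnMmr mulnA expnS.
Qed.

Definition base_pair (x : frobenius21) : 'I_7 * 'I_7 :=
  (gperm phi (f x) o0, gperm phi (f x) o1).

Lemma base_pairE a b : let p := base_pair (ft ^+ a * fs ^+ b) in
  orbit_pair a b = (minn p.1 p.2, maxn p.1 p.2).
Proof. by rewrite /base_pair /= !affine_perm /orbit_pair !inordK // add0n add1n. Qed.

(** With [base_pair_surj] this says that the action on unordered pairs is simply transitive; the
    alternatives account for the order within a pair. *)
Lemma base_pair_inj x y :
  base_pair x = base_pair y \/ base_pair x = ((base_pair y).2, (base_pair y).1) -> x = y.
Proof.
have [a [b [a7 b3 ->]]] := frobenius_elt x; have [c [d [c7 d3 ->]]] := frobenius_elt y.
move=> e; suff [-> ->] : a = c /\ b = d by [].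
apply: orbit_pair_inj => //; rewrite !base_pairE.
by case: e => -> //=; rewrite minnC maxnC.
Qed.

Lemma base_pair_surj i j : i != j -> exists x, base_pair x = (i, j) \/ base_pair x = (j, i).
Proof.
wlog ij : i j / (i < j)%N => [IH ne|_].
  have [ij|ji|/val_inj e] := ltngtP i j; first exact: IH.
    by have [|x [e|e]] := IH j i ji; rewrite 1?eq_sym //; exists x; [right|left].
  by rewrite e eqxx in ne.
have [|a [b [_ _ e]]] := @orbit_pair_surj i j; first by rewrite ij /=.
exists (ft ^+ a * fs ^+ b); move: (base_pairE a b); rewrite e.
case: (base_pair _) => k l [/esym emin /esym emax]; have [kl|lk] := leqP k l.
  by left; congr pair; apply: val_inj; move: emin emax;
    rewrite /= (minn_idPl kl) (maxn_idPr kl).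
right; congr pair; apply: val_inj; move: emin emax;
  by rewrite /= (minn_idPr (ltnW lk)) (maxn_idPl (ltnW lk)).
Qed.

Lemma affine_inj : injective f.
Proof. by move=> x y xy; apply: base_pair_inj; left; rewrite /base_pair xy. Qed.

End AffineMorphism.

(* The cocycle c comparing f and f' is a coboundary because Z^21 is the regular
   permutation module: c(x)(k p) = c(k x)(p) - c(k)(p), so
   it is determined by its values at the base pair p = {0,1}. *)
Lemma affine_conj (f f' : {multiplicative frobenius21 -> G}) :
  affine_morph f -> affine_morph f' -> exists d, forall x, f' x = f x ^ d.
Proof.
move=> fA fA'.
have ff' x : gperm phi (f' x) = gperm phi (f x).
  have [a [b [_ _ ->]]] := frobenius_elt x.
  by apply/permP => i; apply: val_inj; rewrite [LHS]affine_perm // [RHS]affine_perm.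
pose rho x := gperm phi (f x); pose e x i j :=
  (link (phi (f' x)) i j - link (phi (f x)) i j)%R.
have rhoM x y i : rho (x * y) i = rho y (rho x i) by rewrite /rho !gmulfM permM.
have lff' x : lperm (phi (f' x)) = rho x := ff' x.
have lf x : lperm (phi (f x)) = rho x by [].
have eM x y i j : e (x * y) i j = (e x i j + e y (rho x i) (rho x j))%R.
  by rewrite /e !gmulfM !linkM lff' lf; lia.
have pureff' x : gperm phi (f' x / f x) = 1 by rewrite gmulfM multV ff' mulgV.
have eE x i j : e x i j = link (phi (f' x / f x)) i j.
  by rewrite gmulfM multV linkM linkV lff' lf !permK.
(* The crossing numbers of [f' x / f x] are even, so the cocycle can be halved. *)
pose half x : int := sval (cid (pure_even (pureff' x))) o0 o1.
have halfE x : e x o0 o1 = (2 * half x)%R.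
  by rewrite eE /half; case: cid => b /= [_ _ ->].
have eC x i j : e x i j = e x j i.
  by have [b [bC _ bE]] := pure_even (pureff' x); rewrite !eE !bE bC.
have e0 x i : e x i i = 0%R.
  by have [b [_ b0 bE]] := pure_even (pureff' x); rewrite eE bE b0.
pose at_pair i j x := base_pair f x = (i, j) \/ base_pair f x = (j, i).
have at_pair_inj i j x y : at_pair i j x -> at_pair i j y -> x = y.
  move=> xij yij; apply: (base_pair_inj fA).
  by case: xij yij => -> [] ->; [left | right | right | left].
(* Each pair comes from {0,1} by a unique [x]; the default 0 is reached on the diagonal only. *)
pose b i j := if pselect (exists x, i != j /\ at_pair i j x) is left ex
  then half (sval (cid ex)) else 0%R.
have bE i j x : i != j -> at_pair i j x -> b i j = half x.
  move=> ij xij; rewrite /b; case: pselect => [ex|[]]; last by exists x.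
  by case: cid => y /= [_ yij]; rewrite (at_pair_inj _ _ _ _ xij yij).
have b0 i : b i i = 0%R by rewrite /b; case: pselect => // -[x []]; rewrite eqxx.
have bC i j : b i j = b j i.
  have [-> //|ij] := eqVneq i j; have [x xij] := base_pair_surj fA ij.
  by rewrite (bE i j x ij xij) (bE j i x) // 1?eq_sym //; case: xij; [right | left].
have [d d1 dE] := pure_surj bC b0; exists d => x; apply: phi_inj.
have d1' : lperm (phi d) = 1 := d1.
rewrite conjgE !gmulfM multV; apply: link_permP => [|i j].
  by rewrite !lpermM lpermV d1' lff' lf invg1 mul1g mulg1.
rewrite !linkM linkV lpermV d1' invg1 !perm1 lf !dE.
(* This is the coboundary equation: conjugation by the pure element [d] changes the crossing numbers
   of [f x] by exactly the right-hand side. *)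
suff : e x i j = (2 * b (rho x i) (rho x j) - 2 * b i j)%R by rewrite /e; lia.
have [->|ij] := eqVneq i j; first by rewrite e0 !b0.
have rij y : i != j -> at_pair i j y -> e x (rho y o0) (rho y o1) = e x i j.
  by move=> _ [[-> ->] // | [-> ->]]; rewrite eC.
have [y yij] := base_pair_surj fA ij.
have yxij : at_pair (rho x i) (rho x j) (y * x).
  by rewrite /at_pair /base_pair -!/(rho _) !rhoM; case: yij => -[-> ->]; [left | right].
rewrite -(rij y ij yij) (bE _ _ _ ij yij) (bE _ _ _ _ yxij) ?(inj_eq perm_inj) //.
by rewrite -!halfE eM; lia.
Qed.

(** The presentation alone does not show that [ft] is nontrivial; a representation moving a point
    does. *)
Lemma affine_inj_neq1 (f : {multiplicative frobenius21 -> G}) : affine_morph f -> ft != 1.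
Proof.
move=> [_ tA]; apply/eqP => t1; have := tA o0.
by rewrite t1 !mult1 perm1 inordK.
Qed.

(** On elements with trivial permutation crossing numbers are additive, with values in the
    torsion-free group of integers. *)
Lemma torsion_perm (x : G) n : x ^+ n.+1 = 1 -> gperm phi x = 1 -> x = 1.
Proof.
move=> xn x1; apply: phi_inj; rewrite mult1; apply: link_permP => // i j.
have linkX k : link (phi (x ^+ k)) i j = (link (phi x) i j *+ k)%R.
  elim: k => [|k IH]; first by rewrite mult1 link1.
  rewrite expgS gmulfM linkM mulrS (x1 : lperm (phi x) = 1).
  by rewrite !perm1 IH.
have := linkX n.+1; rewrite xn mult1 link1 => /esym/eqP.
by rewrite Num.Theory.mulrn_eq0 /= => /eqP.
Qed.

Definition conj_morph (f : {multiplicative frobenius21 -> G}) g x := f x ^ g.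

Fact conj_morphM f g : {morph conj_morph f g : x y / x * y}.
Proof. by move=> x y; rewrite /conj_morph gmulfM conjMg. Qed.

HB.instance Definition _ f g :=
  isMultiplicative.Build frobenius21 G (conj_morph f g) (conj_morphM f g).

(** By [torsion_perm] the image of [ft] in the symmetric group stays nontrivial, so
    [frob_pair_affine] applies; its conjugating permutation is then lifted to [G]. *)
Lemma inj_affine (f : {multiplicative frobenius21 -> G}) : ft != 1 -> injective f ->
  exists g, affine_morph (conj_morph f g).
Proof.
move=> t1 f_inj; have fp := frob_pair_map f frobenius_pair.
have [_ t7 _] := fp.
have [|r rA] := frob_pair_affine (frob_pair_map (gperm phi) fp).
  apply: contra_neq t1 => /(torsion_perm t7) ft1; apply: f_inj.
  by rewrite ft1 mult1.
have [g gr] := phi_surj r; exists g.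
by move: rA; rewrite -gr /affine_morph /conj_morph !conjgE !gmulfM !multV.
Qed.

(** Both morphisms are first conjugated to affine ones. The conjugacy holds for the morphisms
    themselves, not just for their images. *)
Lemma frobenius_conj (f f' : {multiplicative frobenius21 -> G}) : ft != 1 ->
  injective f -> injective f' -> exists g, forall x, f' x = f x ^ g.
Proof.
move=> t1 /(inj_affine t1)[g fg] /(inj_affine t1)[g' fg'].
have [d fd] := affine_conj fg fg'; exists (g * d * g'^-1) => x.
have {}fd : f' x ^ g' = (f x ^ g) ^ d := fd x.
by rewrite !conjgM -fd conjgK.
Qed.

Lemma range_conj (f f' : {multiplicative frobenius21 -> G}) g :
  (forall x, f' x = f x ^ g) -> conj_class (range f') = conj_class (range f).
Proof.
move=> fg; have rE h : conj_set (range f') h = conj_set (range f) (g * h).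
  rewrite eqEsubset; split=> _ [_ [x _ <-] <-].
    by exists (f x); rewrite ?conjgM ?fg //; exists x.
  by exists (f' x); rewrite ?conjgM ?fg //; exists x.
rewrite eqEsubset; split=> _ [h _ <-].
  by exists (g * h); rewrite -?rE.
by exists (g^-1 * h); rewrite ?rE ?mulKVg ?mulVKg.
Qed.
End FrobeniusConjugacy.

(** * Existence and uniqueness of the conjugacy class *)

Lemma range_subgroup (F G : groupType) (f : {multiplicative F -> G}) :
  is_subgroup (range f).
Proof.
split; first by exists 1; rewrite ?mult1.
by move=> _ _ [x _ <-] [y _ <-]; exists (x / y); rewrite // gmulfM multV.
Qed.

Theorem theorem38 :
  exists! C : set (set (quot (derived (pure_braid 7)))),
    exists H : set (quot (derived (pure_braid 7))),
      [/\ is_subgroup H, isog_subgroup frobenius21 H & C = conj_class H].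
Proof.
(* Existence comes from the explicit braids; their affine action on seven points makes the morphism
   injective. *)
pose f0 := fun b : bool => if b then crystal_t else crystal_s.
have f0P := frobenius_relP (f := f0) crystal_frob_pair.
pose f : {multiplicative frobenius21 -> crystal_group 7} := pres_lift f0P.
have fA : affine_morph (crystal_link 7) f.
  have fE b : f (pres_gen frobenius_rel b) = f0 b := pres_lift_gen f0P b.
  by rewrite /affine_morph !fE; exact: crystal_affine.
have f_inj := affine_inj fA.
exists (conj_class (range f)); split.
  exists (range f); split=> //; first exact: range_subgroup.
  by exists f.
move=> _ [H [_ [f' [f'_inj <-]] ->]].
have [g fg] := frobenius_conj (@crystal_link_inj 5) (@crystal_perm_surj 5)
  (@crystal_pure_even 5) (@crystal_pure_surj 5) (affine_inj_neq1 fA) f_inj f'_inj.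
exact/esym/(range_conj fg).
Qed.
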